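(* For every $t\in\{1,\dots,n\}$, the set $q^{\mathbb{Z}}B^*=\{q^ab(A)\mid A\in M_n(\mathbb{Z}_+),\ a\in\mathbb{Z}\}$ is invariant under multiplication by the quantum minors $\det_q(t)$ and $\sigma(\det_q(t))$. More precisely, for every $A\in M_n(\mathbb{Z}_+)$ with row sums $ro(A)=(r_1,\dots,r_n)$ and column sums $co(A)=(c_1,\dots,c_n)$, $$b(A)\,{\det}_q(t)=q^{r_1+\cdots+r_t-c_{n-t+1}-\cdots-c_n}\,b(A+E_t),$$ $$b(A)\,\sigma({\det}_q(t))=q^{c_1+\cdots+c_t-r_{n-t+1}-\cdots-r_n}\,b(A+E_t^T),$$ where $E_t=\begin{pmatrix}0&I_t\\0&0\end{pmatrix}$ is the $n\times n$ matrix with the identity matrix $I_t$ as its upper right $t\times t$ block and zeros elsewhere, and $E_t^T$ is its transpose.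
   Context: Let $K=\mathbb{Q}(q)$ and $\mathbb{Z}_+=\{0,1,2,\dots\}$. $O_q(M(n))$ is the associative $K$-algebra generated by $Z_{ij}$ ($1\le i,j\le n$) with relations $Z_{ij}Z_{ik}=q^2Z_{ik}Z_{ij}$ if $j<k$; $Z_{ij}Z_{kj}=q^2Z_{kj}Z_{ij}$ if $i<k$; $Z_{ij}Z_{st}=Z_{st}Z_{ij}$ if $i>s,\ j<t$; $Z_{ij}Z_{st}=Z_{st}Z_{ij}+(q^2-q^{-2})Z_{it}Z_{sj}$ if $i<s,\ j<t$. The bar map is the anti-automorphism of $O_q(M(n))$ as a $\mathbb{Q}$-algebra with $Z_{ij}\mapsto Z_{ij}$, $q\mapsto q^{-1}$. $\sigma$ is the $K$-algebra automorphism with $\sigma(Z_{ij})=Z_{ji}$. For $A=(a_{ij})\in M_n(\mathbb{Z}_+)$ let $Z^A=\prod_{i,j}Z_{ij}^{a_{ij}}$ with factors in lexicographic order of $(i,j)$; $D(A)=q^{-\sum_i\sum_{j>k}a_{ij}a_{ik}-\sum_i\sum_{j>k}a_{ji}a_{ki}}$, $Z(A)=D(A)Z^A$, $L^*=\bigoplus_A\mathbb{Z}[q]Z(A)$. $ro(A)$, $co(A)$ are the vectors of row sums and column sums. $B<A$ means that, reading entries in lexicographic order of positions, the first differing entry is smaller in $B$. $B^*=\{b(A)\mid A\in M_n(\mathbb{Z}_+)\}$ is the unique basis of $L^*$ such that $\overline{b(A)}=b(A)$ and $b(A)=Z(A)+\sum_{B<A}h_B(A)Z(B)$ with $h_B(A)\in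 q\mathbb{Z}[q]$, $ro(B)=ro(A)$, $co(B)=co(A)$. For $1\le t\le n$, $\det_q(t)=\det_q(\{1,\dots,t\},\{n-t+1,\dots,n\})$ is the quantum minor with rows $1,\dots,t$ and columns $n-t+1,\dots,n$, that is $\det_q(t)=\sum_{\tau\in S_t}(-q^2)^{l(\tau)}Z_{1,\,n-t+\tau(1)}\cdots Z_{t,\,n-t+\tau(t)}$. *)

(* Defs.v *)
From HB Require Import structures.
From mathcomp Require Import all_boot all_order all_algebra.
From mathcomp Require Import perm boolp monalg.

Set Implicit Arguments.
Unset Strict Implicit.
Unset Printing Implicit Defensive.

Import GRing.Theory.
Local Open Scope ring_scope.
Local Open Scope quotient_scope.

Section QuotientAlgebra.
Variables (K : fieldType) (A : algType K).

Record two_sided_ideal (J : A -> Prop) : Prop := TwoSidedIdeal {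
  ideal_0 : J 0;
  ideal_B : forall x y, J x -> J y -> J (x - y);
  ideal_Ml : forall a x, J x -> J (a * x);
  ideal_Mr : forall a x, J x -> J (x * a) }.

Variable rel : A -> Prop.

Definition ideal_gen : {pred A} := fun x =>
  `[< forall J, two_sided_ideal J -> (forall r, rel r -> J r) -> J x >].

Lemma ideal_genP x : reflect
  (forall J, two_sided_ideal J -> (forall r, rel r -> J r) -> J x)
  (x \in ideal_gen).
Proof. exact: asboolP. Qed.

Lemma ideal_gen_rel r : rel r -> r \in ideal_gen.
Proof. by move=> rr; apply/ideal_genP => J _; apply. Qed.

Lemma ideal_gen_zmod_closed : zmod_closed ideal_gen.
Proof.
split=> [|x y /ideal_genP xI /ideal_genP yI]; apply/ideal_genP => J idJ rJ.
  exact: ideal_0.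
by apply: ideal_B => //; [apply: xI|apply: yI].
Qed.

HB.instance Definition _ :=
  GRing.isZmodClosed.Build A ideal_gen ideal_gen_zmod_closed.

Lemma ideal_gen_Ml a x : x \in ideal_gen -> a * x \in ideal_gen.
Proof.
move=> /ideal_genP xI; apply/ideal_genP => J idJ rJ.
by apply: ideal_Ml => //; apply: xI.
Qed.

Lemma ideal_gen_Mr a x : x \in ideal_gen -> x * a \in ideal_gen.
Proof.
move=> /ideal_genP xI; apply/ideal_genP => J idJ rJ.
by apply: ideal_Mr => //; apply: xI.
Qed.

Hypothesis proper : 1 \notin ideal_gen.

(* The argument [proper] only serves the ring structure, since the ring of an
   [algType] is required to be nontrivial. *)
Definition quot_alg of 1 \notin ideal_gen := Quotient.quot ideal_gen.
Local Notation Q := (quot_alg proper).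
HB.instance Definition _ := GRing.Zmodule.on Q.

Definition quot_pi (x : A) : Q := \pi_(Quotient.quot ideal_gen) x.
Definition quot_repr (x : Q) : A := repr (x : Quotient.quot ideal_gen).

Lemma quot_reprK : cancel quot_repr quot_pi.
Proof. by move=> x; apply: reprK. Qed.

Lemma quot_pi_eqP x y : quot_pi x = quot_pi y <-> x - y \in ideal_gen.
Proof. by rewrite Quotient.idealrBE; split => /eqP. Qed.

Lemma quot_pi_repr x : quot_repr (quot_pi x) - x \in ideal_gen.
Proof. by apply/quot_pi_eqP; rewrite quot_reprK. Qed.

Lemma quot_pi_is_zmod_morphism : zmod_morphism quot_pi.
Proof. by move=> x y; rewrite /quot_pi raddfB. Qed.

HB.instance Definition _ :=
  GRing.isZmodMorphism.Build A Q quot_pi quot_pi_is_zmod_morphism.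

Definition quot_mul (x y : Q) : Q := quot_pi (quot_repr x * quot_repr y).
Definition quot_scale (c : K) (x : Q) : Q := quot_pi (c *: quot_repr x).

Lemma quot_piM x y : quot_pi (x * y) = quot_mul (quot_pi x) (quot_pi y).
Proof.
apply/esym/quot_pi_eqP; set x' := quot_repr _; set y' := quot_repr _.
rewrite -[_ - _](subrKA (x' * y)) -mulrBr -mulrBl rpredD //.
  exact/ideal_gen_Ml/quot_pi_repr.
exact/ideal_gen_Mr/quot_pi_repr.
Qed.

Lemma quot_piZ c x : quot_pi (c *: x) = quot_scale c (quot_pi x).
Proof.
apply/esym/quot_pi_eqP; rewrite -scalerBr -mulr_algl.
exact/ideal_gen_Ml/quot_pi_repr.
Qed.

Lemma quot_ind (P : Q -> Prop) : (forall x, P (quot_pi x)) -> forall x, P x.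
Proof. by move=> Ppi x; rewrite -[x]quot_reprK. Qed.

Lemma quot_mulA : associative quot_mul.
Proof.
by elim/quot_ind=> x; elim/quot_ind=> y; elim/quot_ind=> z;
  rewrite -!quot_piM mulrA.
Qed.

Lemma quot_mul1x : left_id (quot_pi 1) quot_mul.
Proof. by elim/quot_ind=> x; rewrite -quot_piM mul1r. Qed.

Lemma quot_mulx1 : right_id (quot_pi 1) quot_mul.
Proof. by elim/quot_ind=> x; rewrite -quot_piM mulr1. Qed.

Lemma quot_mulDl : left_distributive quot_mul +%R.
Proof.
elim/quot_ind=> x; elim/quot_ind=> y; elim/quot_ind=> z.
by rewrite -raddfD -!quot_piM mulrDl raddfD.
Qed.

Lemma quot_mulDr : right_distributive quot_mul +%R.
Proof.
elim/quot_ind=> x; elim/quot_ind=> y; elim/quot_ind=> z.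
by rewrite -raddfD -!quot_piM mulrDr raddfD.
Qed.

Lemma quot_1_neq0 : quot_pi 1 != 0.
Proof.
rewrite -(raddf0 quot_pi); apply/eqP => /quot_pi_eqP.
by rewrite subr0; apply/negP.
Qed.

HB.instance Definition _ := GRing.Zmodule_isNzRing.Build Q
  quot_mulA quot_mul1x quot_mulx1 quot_mulDl quot_mulDr quot_1_neq0.

Lemma quot_scaleA c d x : quot_scale c (quot_scale d x) = quot_scale (c * d) x.
Proof. by elim/quot_ind: x => x; rewrite -!quot_piZ scalerA. Qed.

Lemma quot_scale1 : left_id 1 quot_scale.
Proof. by elim/quot_ind=> x; rewrite -!quot_piZ scale1r. Qed.

Lemma quot_scaleDr : right_distributive quot_scale +%R.
Proof.
move=> c; elim/quot_ind=> x; elim/quot_ind=> y.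
by rewrite -raddfD -!quot_piZ scalerDr raddfD.
Qed.

Lemma quot_scaleDl x : {morph quot_scale^~ x : c d / c + d}.
Proof. by elim/quot_ind: x => x c d; rewrite -!quot_piZ scalerDl raddfD. Qed.

HB.instance Definition _ := GRing.Zmodule_isLmodule.Build K Q
  quot_scaleA quot_scale1 quot_scaleDr quot_scaleDl.

Lemma quot_scaleAl (c : K) (x y : Q) : c *: (x * y) = (c *: x) * y.
Proof.
elim/quot_ind: x => x; elim/quot_ind: y => y.
rewrite -[LHS]/(quot_scale c (quot_mul _ _)).
rewrite -[RHS]/(quot_mul (quot_scale c _) _).
by rewrite -quot_piM -!quot_piZ -quot_piM scalerAl.
Qed.

HB.instance Definition _ := GRing.Lmodule_isLalgebra.Build K Q quot_scaleAl.

Lemma quot_scaleAr (c : K) (x y : Q) : c *: (x * y) = x * (c *: y).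
Proof.
elim/quot_ind: x => x; elim/quot_ind: y => y.
rewrite -[LHS]/(quot_scale c (quot_mul _ _)).
rewrite -[RHS]/(quot_mul _ (quot_scale c _)).
by rewrite -quot_piM -!quot_piZ -quot_piM scalerAr.
Qed.

HB.instance Definition _ := GRing.Lalgebra_isAlgebra.Build K Q quot_scaleAr.

Lemma quot_pi_is_monoid_morphism : monoid_morphism quot_pi.
Proof. by split=> // x y; rewrite quot_piM. Qed.

HB.instance Definition _ :=
  GRing.isMonoidMorphism.Build A Q quot_pi quot_pi_is_monoid_morphism.

Lemma quot_pi_is_scalable : scalable quot_pi.
Proof. by move=> c x; rewrite quot_piZ. Qed.

HB.instance Definition _ :=
  GRing.isScalable.Build K A Q *:%R quot_pi quot_pi_is_scalable.

End QuotientAlgebra.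

Section FreeAlgebra.
Variables (K : fieldType) (I : choiceType).

Definition free_alg := {malg K[{fmonom I}]}.
HB.instance Definition _ := GRing.Lalgebra.on free_alg.

Definition free_gen (i : I) : free_alg := << fmu i >>.

Lemma free_alg_scaleAr (c : K) (x y : free_alg) : c *: (x * y) = x * (c *: y).
Proof.
have cC (z : {malg K[{fmonom I}]}) : z * malgC c = malgC c * z.
  apply/malgP => k; rewrite mul_malgC mcoeffZ malgM_def.
  rewrite fgmulgU raddf_sum /= {3}[z]monalgE raddf_sum mulr_sumr /=.
  by apply: eq_bigr => m _; rewrite mulm1 !mcoeffU mulrnAr mulrC.
by rewrite -!mul_malgC mulrA -cC -mulrA.
Qed.

HB.instance Definition _ :=
  GRing.Lalgebra_isAlgebra.Build K free_alg free_alg_scaleAr.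

Definition free_aug (x : free_alg) : K := mcoeff (mone : {fmonom I}) x.

Lemma free_aug_is_zmod_morphism : zmod_morphism free_aug.
Proof. exact: mcoeffB. Qed.

HB.instance Definition _ :=
  GRing.isZmodMorphism.Build free_alg K free_aug free_aug_is_zmod_morphism.

Lemma free_aug_is_monoid_morphism : monoid_morphism free_aug.
Proof. by have [? ?] := @mcoeff1g_is_multiplicative {fmonom I} K; split. Qed.

HB.instance Definition _ :=
  GRing.isMonoidMorphism.Build free_alg K free_aug free_aug_is_monoid_morphism.

Lemma free_augZ c x : free_aug (c *: x) = c * free_aug x.
Proof. exact: mcoeffZ. Qed.

Lemma free_aug_gen i : free_aug (free_gen i) = 0.
Proof. by rewrite /free_aug /free_gen mcoeffU1 -val_eqE /= fm1 /fmu fmE. Qed.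

End FreeAlgebra.

Section QuantumMatrixRelations.
Variables (K : fieldType) (q : K) (n : nat).
Variables (F : algType K) (X : 'I_n -> 'I_n -> F).

Variant Oq_relator : F -> Prop :=
| Oq_row (i j k : 'I_n) of (j < k)%N :
    Oq_relator (X i j * X i k - q ^+ 2 *: (X i k * X i j))
| Oq_col (i j k : 'I_n) of (i < k)%N :
    Oq_relator (X i j * X k j - q ^+ 2 *: (X k j * X i j))
| Oq_anti (i j s t : 'I_n) of (s < i)%N & (j < t)%N :
    Oq_relator (X i j * X s t - X s t * X i j)
| Oq_diag (i j s t : 'I_n) of (i < s)%N & (j < t)%N :
    Oq_relator (X i j * X s t -
      (X s t * X i j + (q ^+ 2 - q ^- 2) *: (X i t * X s j))).

Lemma Oq_relator_proper (phi : {rmorphism F -> K}) :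
    (forall c x, phi (c *: x) = c * phi x) -> (forall i j, phi (X i j) = 0) ->
  1 \notin ideal_gen Oq_relator.
Proof.
move=> phiZ phi0; apply/negP => /ideal_genP /(_ (fun x => phi x = 0)) phi1.
suff /eqP : phi 1 = 0 by rewrite rmorph1 oner_eq0.
apply: phi1.
  split=> [|x y x0 y0|a x x0|a x x0]; first exact: rmorph0.
  - by rewrite rmorphB x0 y0 subrr.
  - by rewrite rmorphM x0 mulr0.
  - by rewrite rmorphM x0 mul0r.
have phi2 i j s t : phi (X i j * X s t) = 0 by rewrite rmorphM phi0 mul0r.
move=> _ [i j k _|i j k _|i j s t _ _|i j s t _ _]; rewrite rmorphB.
- by rewrite phiZ !phi2 mulr0 subr0.
- by rewrite phiZ !phi2 mulr0 subr0.
- by rewrite !phi2 subr0.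
- by rewrite rmorphD phiZ !phi2 mulr0 addr0 subr0.
Qed.

End QuantumMatrixRelations.

Section QuantumMatrices.
Variables (K : fieldType) (q : K) (n : nat).

Definition free_Z (i j : 'I_n) : free_alg K ('I_n * 'I_n)%type :=
  free_gen K (i, j).

Lemma Oq_proper : 1 \notin ideal_gen (Oq_relator q free_Z).
Proof.
apply: (@Oq_relator_proper _ _ _ _ _ (@free_aug K ('I_n * 'I_n)%type)).
  exact: free_augZ.
by move=> i j; apply: free_aug_gen.
Qed.

Definition Oq := quot_alg Oq_proper.
HB.instance Definition _ := GRing.Algebra.on Oq.

Definition Zgen (i j : 'I_n) : Oq := quot_pi Oq_proper (free_Z i j).

Lemma Zgen_row (i j k : 'I_n) : (j < k)%N ->
  Zgen i j * Zgen i k = q ^+ 2 *: (Zgen i k * Zgen i j).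
Proof.
move=> jk; rewrite /Zgen -!rmorphM -linearZ; apply/quot_pi_eqP.
exact/ideal_gen_rel/Oq_row.
Qed.

Lemma Zgen_col (i j k : 'I_n) : (i < k)%N ->
  Zgen i j * Zgen k j = q ^+ 2 *: (Zgen k j * Zgen i j).
Proof.
move=> ik; rewrite /Zgen -!rmorphM -linearZ; apply/quot_pi_eqP.
exact/ideal_gen_rel/Oq_col.
Qed.

Lemma Zgen_anti (i j s t : 'I_n) : (s < i)%N -> (j < t)%N ->
  Zgen i j * Zgen s t = Zgen s t * Zgen i j.
Proof.
move=> si jt; rewrite /Zgen -!rmorphM; apply/quot_pi_eqP.
exact/ideal_gen_rel/Oq_anti.
Qed.

Lemma Zgen_diag (i j s t : 'I_n) : (i < s)%N -> (j < t)%N ->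
  Zgen i j * Zgen s t =
    Zgen s t * Zgen i j + (q ^+ 2 - q ^- 2) *: (Zgen i t * Zgen s j).
Proof.
move=> si jt; rewrite /Zgen -!rmorphM -linearZ -raddfD; apply/quot_pi_eqP.
exact/ideal_gen_rel/Oq_diag.
Qed.

End QuantumMatrices.

Notation Qq := {fraction {poly rat}}.
Definition q : Qq := tofrac 'X.

Section DualCanonicalBasis.
Variable n : nat.
Local Notation O := (Oq q n).
Local Notation mat := 'M[nat]_n.

Record is_bar (bar : O -> O) : Prop := IsBar {
  bar_bij : bijective bar;
  bar_D : {morph bar : x y / x + y};
  (* Linearity over the subfield Q of Q(q). *)
  bar_ratZ : forall (c : rat) x, bar (ratr c *: x) = ratr c *: bar x;
  bar_1 : bar 1 = 1;
  bar_M : forall x y, bar (x * y) = bar y * bar x;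
  bar_Zgen : forall i j, bar (Zgen q i j) = Zgen q i j;
  bar_q : bar q%:A = q^-1%:A }.

Definition is_sigma (sigma : {lrmorphism O -> O}) : Prop :=
  bijective sigma /\ forall i j, sigma (Zgen q i j) = Zgen q j i.

(* The subring Z[q] of Q(q), and its ideal q Z[q]. *)
Definition Zq (c : Qq) : Prop := exists p : {poly int}, c = (map_poly intr p).[q].
Definition qZq (c : Qq) : Prop := exists2 d, Zq d & c = q * d.

(* Products over ordinals are taken in increasing order of the index. *)
Definition Zmon (A : mat) : O := \prod_(i < n) \prod_(j < n) Zgen q i j ^+ A i j.

Definition Dfac (A : mat) : Qq :=
  q ^- (\sum_(i < n) \sum_(j < n) \sum_(k < n | (k < j)%N) A i j * A i k +
        \sum_(i < n) \sum_(j < n) \sum_(k < n | (k < j)%N) A j i * A k i)%N.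

Definition Znorm (A : mat) : O := Dfac A *: Zmon A.

Definition ro (A : mat) : 'rV[nat]_n := \row_i (\sum_(j < n) A i j)%N.
Definition co (A : mat) : 'rV[nat]_n := \row_j (\sum_(i < n) A i j)%N.

Definition mxlex_lt (B A : mat) : Prop :=
  exists i j, (B i j < A i j)%N /\
    forall k l : 'I_n, (k < i)%N || (k == i) && (l < j)%N -> B k l = A k l.

Definition Zq_span (F : mat -> O) (x : O) : Prop :=
  exists (s : seq mat) (c : mat -> Qq),
    (forall B, Zq (c B)) /\ x = \sum_(B <- s) c B *: F B.

Definition Zq_free (F : mat -> O) : Prop :=
  forall (s : seq mat) (c : mat -> Qq), uniq s -> (forall B, Zq (c B)) ->
    \sum_(B <- s) c B *: F B = 0 -> {in s, forall B, c B = 0}.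

Definition Lstar : O -> Prop := Zq_span Znorm.

Record is_dual_canonical_basis (bar : O -> O) (b : mat -> O) : Prop :=
  IsDualCanonicalBasis {
    dcb_free : Zq_free b;
    dcb_span : forall x, Lstar x <-> Zq_span b x;
    dcb_bar : forall A, bar (b A) = b A;
    dcb_unitri : forall A, exists (s : seq mat) (h : mat -> Qq),
      [/\ uniq s,
          {in s, forall B, [/\ mxlex_lt B A, qZq (h B),
                               ro B = ro A & co B = co A]} &
          b A = Znorm A + \sum_(B <- s) h B *: Znorm B] }.

(* The set q^Z B^*. *)
Definition qZB (b : mat -> O) (x : O) : Prop :=
  exists (a : int) (A : mat), x = q ^ a *: b A.

(* The Coxeter length, as the number of inversions. *)
Definition perm_len t (tau : 'S_t) : nat :=
  #|[set p : 'I_t * 'I_t | (p.1 < p.2)%N && (tau p.2 < tau p.1)%N]|.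

Section Minor.
Variables (t : nat) (tn : (t <= n)%N).

(* The column n - t + k, with 0-based k. *)
Definition last_ord (k : 'I_t) : 'I_n := cast_ord (subnK tn) (rshift (n - t) k).

Definition detq : O :=
  \sum_(tau : 'S_t) (- q ^+ 2) ^+ perm_len tau *:
    \prod_(i < t) Zgen q (widen_ord tn i) (last_ord (tau i)).
End Minor.

Definition Emx (t : nat) : mat :=
  \matrix_(i, j) ((i < t)%N && (j == n - t + i :> nat)%N : nat).

Definition sum_first (t : nat) (v : 'rV[nat]_n) : nat :=
  (\sum_(i < n | i < t) v ord0 i)%N.
Definition sum_last (t : nat) (v : 'rV[nat]_n) : nat :=
  (\sum_(i < n | n - t <= i) v ord0 i)%N.

End DualCanonicalBasis.

(* Main.v *)
(** A minor M in the rows below row s is moved to the right through the monomial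
    Z_{s1}^{a_1} ... Z_{sn}^{a_n} of row s, one column at a time.  After rescaling
    the powers by q^{a(a-1)} and q^{a(a+1)}, all structure constants of this
    process lie in Z[q].  Removing one row after the other this shows
    det_q(t) Z(A) = q^m (Z(A + E_t) + q y) with y in L^*, where m depends on
    ro(A) and co(A) only.  The anti-automorphism Z_{ij} -> Z_{n+1-j,n+1-i} fixes
    det_q(t) and permutes the Z(A), whence Z(A) det_q(t) = q^{-m} (Z(A + E_t) + q y').
    As b(A) = Z(A) modulo q L^*, the element x = q^{-m} det_q(t) b(A) and its
    image q^m b(A) det_q(t) under the bar map are both congruent to b(A + E_t)
    modulo q L^*.  An element of q L^* whose bar image is in q L^* as well is zero,
    so both are equal to b(A + E_t).  Finally sigma(b(A)) = b(A^T) for the same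
    reason. *)

From HB Require Import structures.
Require Import Defs.
From mathcomp Require Import all_boot all_order all_algebra.
From mathcomp Require Import fingroup perm.
From mathcomp Require boolp.
From mathcomp Require Import zify ring.

Set Implicit Arguments.
Unset Strict Implicit.
Unset Printing Implicit Defensive.

Import GRing.Theory.
Local Open Scope ring_scope.

(** * Quantum Laplace expansions *)

(** Origin of the exponents [a(a-1)] and [a(a+1)]: by polarization, D(A) is [q] to the sum of the
    squared entries of [A], up to a factor fixed by the row and column sums. Normalizing each power
    by [q ^+ (a * a)] is therefore as good as using D(A), and it is compatible with peeling off one
    factor at a time. The shift by [a] up or down in the first [t] rows adds up to their row sums,
    so it again depends on the row sums only. All monomials of one product have the same row and
    column sums, hence one common power of [q] leads back to Z(A).

    Why a corner minor: in the passage through a row, a nonleading coefficient with nonzero constant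
    term, [1 - q ^+ (4 * a)], arises only when the minor without its entry in that row passes a
    column outside its column set. If the columns form a final segment, this never happens to the
    leading term, and every branch leaving it carries a factor [q]. So integrality is shown for all
    column sets, and the leading term is followed for final segments only.

    The algebra is kept abstract, with a family [Z] satisfying the relations, in order to apply the
    result to the opposite algebra as well. *)

Section Counting.
Variable n : nat.
Implicit Types (J : {set 'I_n}) (x : 'I_n).

Definition cnt (k : nat) J (j : nat) : nat := (\sum_(i in J) (k <= i < j))%N.

Lemma cnt_ge k J j : (j <= k)%N -> cnt k J j = 0%N.
Proof. by move=> jk; apply: big1 => i _; lia. Qed.

Lemma cnt_cat k m J j : (k <= m <= j)%N -> cnt k J j = (cnt k J m + cnt m J j)%N.
Proof. by move=> kmj; rewrite /cnt -big_split; apply: eq_bigr => i _ /=; lia. Qed.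

Lemma cntD1 k J j x : x \in J -> cnt k J j = ((k <= x < j) + cnt k (J :\ x) j)%N.
Proof. exact: big_setD1. Qed.

Lemma cntU1 k J j x :
  x \notin J -> cnt k (x |: J) j = ((k <= x < j) + cnt k J j)%N.
Proof. exact: big_setU1. Qed.

Lemma cnt_first x J j : (x < j)%N -> cnt x J j = ((x \in J) + cnt x.+1 J j)%N.
Proof.
move=> xj; rewrite (cnt_cat (m := x.+1)); last lia.
congr addn; rewrite /cnt; case xJ: (x \in J).
  rewrite (big_setD1 x) //= big1 => [|i]; first by lia.
  by rewrite !inE -val_eqE => /andP[/eqP /= ? _]; lia.
rewrite big1 // => i iJ; have : val i != val x.
  by apply: contraFneq xJ => /val_inj <-.
by move=> /eqP /= ?; lia.
Qed.

End Counting.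

Section QuantumLaplace.
Variables (K : fieldType) (q : K) (A : algType K) (n : nat).
Local Notation p := (- q ^+ 2).
Implicit Types (z : 'I_n -> A) (Phi : {set 'I_n} -> A) (J : {set 'I_n}).

(* For k = 0 this is a Laplace expansion along a row with entries z; larger k
   gives the part of the expansion in the columns from k on. *)
Definition laplace (k : nat) z Phi J : A :=
  \sum_(j in J | (k <= j)%N) p ^+ cnt k J j *: (z j * Phi (J :\ j)).

Lemma laplace_ge k z Phi J : (n <= k)%N -> laplace k z Phi J = 0.
Proof.
by move=> nk; apply: big_pred0 => j; have := ltn_ord j; case: (j \in J) => //=; lia.
Qed.

Lemma laplace_notin (k : 'I_n) z Phi J :
  k \notin J -> laplace k z Phi J = laplace k.+1 z Phi J.
Proof.
move=> kJ; apply: eq_big => [j|j].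
  case jJ: (j \in J) => //=; have : val j != val k.
    by apply: contraNneq kJ => /val_inj <-.
  by move=> /eqP /= ?; lia.
case/andP=> jJ kj; have jk : val j != val k.
  by apply: contraNneq kJ => /val_inj <-.
rewrite cnt_first ?(negbTE kJ) //; move/eqP: jk => /= ?; lia.
Qed.

Lemma laplace_in (k : 'I_n) z Phi J : k \in J ->
  laplace k z Phi J = z k * Phi (J :\ k) + p *: laplace k.+1 z Phi J.
Proof.
move=> kJ; rewrite /laplace (bigD1 k) ?kJ /= ?leqnn //.
rewrite cnt_ge // expr0 scale1r; congr (_ + _); rewrite scaler_sumr.
apply: eq_big => [j|j].
  by rewrite -val_eqE /=; case: (j \in J) => //=; lia.
move=> /andP[/andP[jJ kj]]; rewrite -val_eqE /= => jk.
by rewrite cnt_first ?kJ ?add1n ?exprS ?scalerA //; lia.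
Qed.

Lemma laplaceU (k : 'I_n) z Phi J : k \notin J ->
  laplace k.+1 z Phi (k |: J) = laplace k.+1 z (fun X => Phi (k |: X)) J.
Proof.
move=> kJ; apply: eq_big => [j|j].
  by rewrite in_setU1; case: eqP => [->|] //=; rewrite ltnn andbF.
move=> /andP[_ kj]; rewrite cntU1 // ltnn add0n; congr (_ *: (_ * Phi _)).
apply/setP => x; rewrite !inE; case: (x =P j) => [->|] //=.
by rewrite -val_eqE gtn_eqF.
Qed.

Lemma laplace0_split (k : nat) z Phi J :
  laplace 0 z Phi J =
    \sum_(j in J | (j < k)%N) p ^+ cnt 0 J j *: (z j * Phi (J :\ j))
    + p ^+ cnt 0 J k *: laplace k z Phi J.
Proof.
rewrite /laplace (bigID (fun j : 'I_n => (j < k)%N)) /=; congr (_ + _).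
  by apply: eq_bigl => j; case: (j \in J).
rewrite scaler_sumr; apply: eq_big => [j|j]; first by rewrite -leqNgt; case: (j \in J).
move=> /andP[_ kj]; rewrite (cnt_cat (m := k)) ?exprD ?scalerA //; lia.
Qed.

(** Each pair [j < l] is removed in two orders. If [j] goes first, it no longer counts to the left
    of [l], so this order has one factor [- q ^+ 2] less; the two terms combine to a 2x2 quantum
    minor. *)
Lemma laplace2 k z z' Phi J :
  laplace k z (laplace k z' Phi) J =
    \sum_(j in J | (k <= j)%N) \sum_(l in J | (j < l)%N)
      p ^+ (cnt k J j + cnt k J l).-1 *:
        ((z j * z' l - q ^+ 2 *: (z l * z' j)) * Phi (J :\ j :\ l)).
Proof.
pose P (j : 'I_n) := (j \in J) && (k <= j)%N.
pose F (j l : 'I_n) :=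
  p ^+ (cnt k J j + (cnt k J l - (j < l)))%N *: (z j * z' l * Phi (J :\ j :\ l)).
have -> : laplace k z (laplace k z' Phi) J =
    \sum_(j | P j) \sum_(l | P l && (j != l)) F j l.
  apply: eq_bigr => j /andP[jJ kj].
  rewrite mulr_sumr scaler_sumr; apply: eq_big => [l|l].
    by rewrite /P in_setD1 eq_sym; case: (j != l); rewrite /= ?andbT ?andbF.
  rewrite in_setD1 => /andP[/andP[lj lJ] kl].
  rewrite -scalerAr scalerA -exprD mulrA; congr (_ ^+ (_ + _) *: _).
  rewrite [cnt k J l](cntD1 _ _ jJ) kj /=; case: (j < l)%N; rewrite ?addKn ?subn0 //.
transitivity (\sum_(j | P j) \sum_(l | P l && (j < l)%N) F j l +
    \sum_(j | P j) \sum_(l | P l && (l < j)%N) F j l).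
  rewrite -big_split; apply: eq_bigr => j _ /=.
  rewrite (bigID (fun l : 'I_n => (j < l)%N)) /=; congr (_ + _);
    apply: eq_bigl => l; rewrite -val_eqE /=; case: (P l) => //=; lia.
rewrite [X in _ + X](exchange_big_dep P) /=; last by move=> ? ? _ /andP[].
rewrite -big_split /=; apply: eq_bigr => j Pj; have /andP[jJ kj] := Pj.
have condE (l : 'I_n) : (j < l)%N -> P l = (l \in J) by rewrite /P; case: (l \in J) => //=; lia.
rewrite [X in _ + X](eq_bigl (fun l => P l && (j < l)%N)); last first.
  by move=> l; rewrite Pj /= andbC.
rewrite -big_split /=; apply: eq_big => [l|l /andP[Pl jl]].
  by case jl: (j < l)%N; rewrite ?andbF ?andbT ?condE.
have lJ : l \in J by rewrite -condE.
have cl : (0 < cnt k J l)%N by rewrite (cntD1 _ _ jJ) kj jl.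
rewrite /F jl (ltnNge l j) (ltnW jl) /= subn0 mulrBl scalerBr.
have -> : (cnt k J j + (cnt k J l - 1) = (cnt k J j + cnt k J l).-1)%N by lia.
congr (_ + _); rewrite addnC.
have -> : (J :\ l :\ j) = (J :\ j :\ l) by apply/setP => i; rewrite !inE; do 2 case: eqP.
rewrite -[X in p ^+ X](prednK (_ : 0 < _)%N); last by lia.
by rewrite exprSr -scalerAl scalerA mulrN scaleNr.
Qed.

(** Reduces identities between double expansions to identities between 2x2 minors: [la = 0] will
    treat a repeated row, [la = - q ^+ 2] the exchange of two rows. *)
Lemma laplace2_scale (k : nat) z z' w w' (la : K) Phi J :
  (forall j l : 'I_n, (k <= j)%N -> (j < l)%N ->
    z j * z' l - q ^+ 2 *: (z l * z' j) =
      la *: (w j * w' l - q ^+ 2 *: (w l * w' j))) ->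
  laplace k z (laplace k z' Phi) J = la *: laplace k w (laplace k w' Phi) J.
Proof.
move=> zw; rewrite !laplace2 scaler_sumr; apply: eq_bigr => j /andP[_ kj].
rewrite scaler_sumr; apply: eq_bigr => l /andP[_ jl].
by rewrite zw // -scalerAl !scalerA [la * _]mulrC.
Qed.

Record qmatrix (Z : 'I_n -> 'I_n -> A) : Prop := QMatrix {
  qmx_row : forall i j k : 'I_n, (j < k)%N ->
    Z i j * Z i k = q ^+ 2 *: (Z i k * Z i j);
  qmx_col : forall i j k : 'I_n, (i < k)%N ->
    Z i j * Z k j = q ^+ 2 *: (Z k j * Z i j);
  qmx_anti : forall i j s t : 'I_n, (s < i)%N -> (j < t)%N ->
    Z i j * Z s t = Z s t * Z i j;
  qmx_diag : forall i j s t : 'I_n, (i < s)%N -> (j < t)%N ->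
    Z i j * Z s t = Z s t * Z i j + (q ^+ 2 - q ^- 2) *: (Z i t * Z s j) }.

Hypothesis q0 : q != 0.
Variable Z : 'I_n -> 'I_n -> A.
Hypothesis Zq : qmatrix Z.

(** Rows may come in any order, which [minor_rev] exploits. The base case makes the minor vanish
    when the numbers of rows and columns differ, so no cardinality condition has to be carried
    along. *)
Fixpoint minor (rs : seq 'I_n) J : A :=
  if rs is i :: rs' then laplace 0 (Z i) (minor rs') J else (J == set0)%:R.

Lemma laplace2_row (k : nat) (i : 'I_n) Phi J :
  laplace k (Z i) (laplace k (Z i) Phi) J = 0.
Proof.
rewrite (@laplace2_scale _ _ _ (Z i) (Z i) 0) ?scale0r // => j l _ jl.
by rewrite (qmx_row Zq) // scale0r subrr.
Qed.

Lemma laplace2_swap (k : nat) (i s : 'I_n) Phi J : (i < s)%N ->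
  laplace k (Z s) (laplace k (Z i) Phi) J =
    p *: laplace k (Z i) (laplace k (Z s) Phi) J.
Proof.
move=> si; apply: laplace2_scale => j l _ jl.
rewrite (qmx_anti Zq si jl) (qmx_diag Zq si jl) -addrA -scalerBl scalerDr scalerA.
have -> : p * (q ^+ 2 - q ^- 2 - q ^+ 2) = 1 by field.
by rewrite scale1r addrC scaleNr.
Qed.

(** Induction on the rows: expand along the first row [i] and split at column [k]. Entries of row
    [i] left of [k] commute with [Z s k], the entry in column [k] does so up to [q ^- 2], and an
    entry in a column [j] right of [k] leaves a correction [Z s j * Z i k]. *)
Lemma minor_mulZ (s k : 'I_n) rs J : all (fun i : 'I_n => s < i)%N rs ->
  minor rs J * Z s k =
    if k \in J then q ^- 2 *: (Z s k * minor rs J) else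
      Z s k * minor rs J
      - (q ^+ 2 - q ^- 2) *: laplace k.+1 (Z s) (minor rs) (k |: J).
Proof.
elim: rs J => [|i rs IHrs] J /=.
  move=> _; case: ifP => kJ.
    have -> : (J == set0) = false by apply/eqP => J0; rewrite J0 inE in kJ.
    by rewrite mul0r mulr0 scaler0.
  rewrite mulr_natl mulr_natr /laplace big1 ?scaler0 ?subr0 // => j /andP[jJ kj].
  have -> : ((k |: J) :\ j == set0) = false; last by rewrite mulr0 scaler0.
  apply/eqP => /setP /(_ k); rewrite !inE eqxx andbT -val_eqE /=; lia.
case/andP=> si srs; have {}IHrs J' := IHrs J' srs.
set c : K := q ^+ 2 - q ^- 2 in IHrs *.
set w : K := p ^+ cnt 0 J k; set M := minor rs in IHrs *.
have below (j : 'I_n) : (j < k)%N -> Z i j * Z s k = Z s k * Z i j.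
  exact: qmx_anti.
have above (j : 'I_n) : (k < j)%N -> Z i j * Z s k = Z s k * Z i j - c *: (Z s j * Z i k).
  by move=> kj; rewrite (qmx_diag Zq si kj) addrK.
have mid J' : \sum_(j in J' | (k < j)%N)
      p ^+ cnt k.+1 J' j *: (Z s j * Z i k * M (J' :\ j)) =
    Z i k * laplace k.+1 (Z s) M J'.
  rewrite mulr_sumr; apply: eq_bigr => j /andP[_ kj].
  by rewrite -scalerAr mulrA (qmx_anti Zq si kj).
have kD (j : 'I_n) : j != k -> (k \in J :\ j) = (k \in J).
  by move=> jk; rewrite in_setD1 eq_sym jk.
rewrite (laplace0_split k) mulrDl -scalerAl -/w; case: ifPn => kJ.
  have -> : (\sum_(j in J | (j < k)%N) p ^+ cnt 0 J j *: (Z i j * M (J :\ j))) *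
      Z s k = q ^- 2 *: (Z s k *
      \sum_(j in J | (j < k)%N) p ^+ cnt 0 J j *: (Z i j * M (J :\ j))).
    rewrite mulr_suml mulr_sumr scaler_sumr; apply: eq_bigr => j /andP[jJ jk].
    rewrite -scalerAl -mulrA IHrs kD ?kJ -?val_eqE ?ltn_eqF //.
    by rewrite -!scalerAr !mulrA below // !scalerA mulrC.
  rewrite mulrDr scalerDr; congr (_ + _).
  rewrite -scalerAr [RHS]scalerA mulrC -scalerA; congr (_ *: _).
  (* As [k] is missing from [J :\ k], this term has a correction too; it cancels the one from the
     columns right of [k] because [- q ^+ 2 * q ^- 2 = -1]. *)
  rewrite laplace_in // mulrDl -mulrA IHrs !inE eqxx /= setD1K // -scalerAl.
  have -> : laplace k.+1 (Z i) M J * Z s k =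
      q ^- 2 *: (Z s k * laplace k.+1 (Z i) M J
                 - c *: (Z i k * laplace k.+1 (Z s) M J)).
    rewrite -mid [laplace _ _ _ _ * _]mulr_suml mulr_sumr scaler_sumr -sumrB.
    rewrite scaler_sumr; apply: eq_bigr => j /andP[jJ kj].
    rewrite -scalerAl -[_ * M _ * Z s k]mulrA IHrs kD ?kJ -?val_eqE ?gtn_eqF //.
    rewrite -!scalerAr !mulrA above // mulrBl -scalerAl.
    by rewrite !scalerBr !scalerA; congr (_ *: _ - _ *: _); ring.
  rewrite mulrBr mulrDr [RHS]scalerDr mulrA -!scalerAr.
  have -> : Z i k * Z s k = q ^- 2 *: (Z s k * Z i k).
    by rewrite (qmx_col Zq _ si) scalerA mulVf ?scale1r // expf_neq0.
  have pq : p * q ^- 2 = -1 by field.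
  rewrite -scalerAl -mulrA -addrA; congr (_ + _).
  by rewrite scalerA pq scaleN1r opprB addKr scalerA mulrC pq scaleN1r.
pose MU Y := M (k |: Y).
pose B := \sum_(j in J | (j < k)%N)
  p ^+ cnt 0 J j *: (Z i j * laplace k.+1 (Z s) M (k |: J :\ j)).
have -> : (\sum_(j in J | (j < k)%N) p ^+ cnt 0 J j *: (Z i j * M (J :\ j))) *
    Z s k = Z s k *
    (\sum_(j in J | (j < k)%N) p ^+ cnt 0 J j *: (Z i j * M (J :\ j))) - c *: B.
  rewrite mulr_suml mulr_sumr scaler_sumr -sumrB; apply: eq_bigr => j /andP[jJ jk].
  rewrite -scalerAl -mulrA IHrs kD ?(negbTE kJ) -?val_eqE ?ltn_eqF //.
  rewrite mulrBr mulrA below // -mulrA -!scalerAr scalerBr; congr (_ - _).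
  by rewrite !scalerA mulrC.
have -> : laplace k (Z i) M J * Z s k = Z s k * laplace k (Z i) M J
    - c *: (Z i k * laplace k.+1 (Z s) M J)
    - c *: laplace k.+1 (Z i) (laplace k.+1 (Z s) MU) J.
  rewrite !(laplace_notin _ _ kJ) -mid [laplace _ _ _ _ * _]mulr_suml.
  rewrite mulr_sumr !scaler_sumr -!sumrB; apply: eq_bigr => j /andP[jJ kj].
  have kJj : k \notin J :\ j by rewrite kD // -val_eqE gtn_eqF.
  rewrite -scalerAl -[_ * M _ * Z s k]mulrA IHrs (negbTE kJj) laplaceU //.
  rewrite mulrBr mulrA above // mulrBl !scalerBr -!scalerAr -!scalerAl !mulrA.
  by rewrite !scalerA [c * _]mulrC.
(* The expected correction, split by the position of the entry of row [i]: left of [k], at [k],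
   right of [k]. The last part is a double expansion in the order [s], [i]; [laplace2_swap] brings
   the one in the order [i], [s] found above to this form. *)
have -> : laplace k.+1 (Z s) (laplace 0 (Z i) M) (k |: J) =
    B + w *: (Z i k * laplace k.+1 (Z s) M J
              + p *: laplace k.+1 (Z s) (laplace k.+1 (Z i) MU) J).
  rewrite laplaceU // scalerDr -mid !scaler_sumr /B.
  transitivity (\sum_(l in J | (k < l)%N) p ^+ cnt k.+1 J l *: (Z s l *
      \sum_(j in J | (j < k)%N) p ^+ cnt 0 J j *: (Z i j * M (k |: J :\ j :\ l)))
    + (\sum_(l in J | (k < l)%N) w *: (p ^+ cnt k.+1 J l *: (Z s l * Z i k * M (J :\ l)))
       + \sum_(l in J | (k < l)%N) w *: (p *: (p ^+ cnt k.+1 J l *: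
           (Z s l * laplace k.+1 (Z i) MU (J :\ l)))))).
    rewrite -!big_split; apply: eq_bigr => l /andP[lJ kl] /=.
    have kJl : k \notin J :\ l by rewrite kD // -val_eqE gtn_eqF.
    have cntJ j : (j <= k)%N -> cnt 0 (k |: J :\ l) j = cnt 0 J j.
      by move=> jk; rewrite cntU1 // (cntD1 _ _ lJ) !ltnNge jk (leq_trans jk (ltnW kl)).
    rewrite (laplace0_split k) laplace_in ?setU11 // setU1K // laplaceU //.
    rewrite !mulrDr scalerDr cntJ // -/w; congr (_ + _).
      congr (_ *: (_ * _)); apply: eq_big => [j|j].
        case jk: (j < k)%N; rewrite ?andbF // !inE -!val_eqE /=.
        by rewrite (ltn_eqF jk) (ltn_eqF (ltn_trans jk kl)).
      move=> /andP[_ jk]; rewrite cntJ ?(ltnW jk) //; congr (_ *: (_ * M _)).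
      apply/setP => x; rewrite !inE; case: (x =P j) => [->|_] //=.
      by rewrite -val_eqE /= (ltn_eqF jk) andbF.
    rewrite -scalerDr -scalerAr [LHS]scalerA [_ * w]mulrC -scalerA; congr (w *: _).
    rewrite [p *: (_ *: _)]scalerA [p * _]mulrC -scalerA -scalerDr.
    by rewrite mulrDr mulrA -scalerAr.
  congr (_ + _).
  under eq_bigr do rewrite mulr_sumr scaler_sumr.
  rewrite (exchange_big_dep (fun j => (j \in J) && (j < k)%N)) //=.
  apply: eq_bigr => j /andP[jJ jk].
  rewrite laplaceU; last by rewrite in_setD1 (negbTE kJ) andbF.
  rewrite mulr_sumr scaler_sumr; apply: eq_big => [l|l].
    rewrite jJ jk andbT in_setD1; case kl: (k < l)%N; rewrite ?andbF //.
    by rewrite -val_eqE /= (gtn_eqF (ltn_trans jk kl)) andbT.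
  move=> /andP[/andP[lJ kl] _].
  rewrite [cnt k.+1 J l](cntD1 _ _ jJ) ltnNge (ltnW jk) add0n -!scalerAr !mulrA.
  rewrite (qmx_anti Zq si (ltn_trans jk kl)) !scalerA.
  by congr (_ *: (_ * M _)); rewrite mulrC.
rewrite (laplace2_swap _ _ _ si) mulrDr -!scalerAr !scalerDr !scalerN.
rewrite !opprD -!addrA; congr (_ + _); rewrite [LHS]addrCA; congr (_ + _).
congr (_ + _); by rewrite !scalerA; congr (- (_ *: _) - _ *: _); ring.
Qed.

End QuantumLaplace.

(** * Moving a minor past a power of one generator *)

Section RowPush.
Variables (K : fieldType) (q : K) (A : algType K) (n : nat).
Hypothesis q0 : q != 0.
Variable Z : 'I_n -> 'I_n -> A.
Hypothesis Zq : qmatrix q Z.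
Variables (s : 'I_n) (rs : seq 'I_n).
Hypothesis srs : all (fun i : 'I_n => s < i)%N rs.

Implicit Types J : {set 'I_n}.
Local Notation p := (- q ^+ 2).
Local Notation M := (minor q Z rs).
Local Notation N k := (laplace q k (Z s) M).

Lemma qcommX (c : K) (x y : A) a :
  x * y = c *: (y * x) -> x * y ^+ a = c ^+ a *: (y ^+ a * x).
Proof.
move=> xy; elim: a => [|a IHa]; first by rewrite !expr0 scale1r mulr1 mul1r.
by rewrite exprS mulrA xy -scalerAl -[y * x * _]mulrA IHa -scalerAr scalerA mulrA -!exprS.
Qed.

Lemma row_mulX (k j : 'I_n) a : (k < j)%N ->
  Z s j * Z s k ^+ a = (q ^- 2) ^+ a *: (Z s k ^+ a * Z s j).
Proof.
move=> kj; apply: qcommX.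
by rewrite (qmx_row Zq _ kj) scalerA mulVf ?scale1r // expf_neq0.
Qed.

Lemma minor_mulX_in (k : 'I_n) J a : k \in J ->
  M J * Z s k ^+ a = (q ^- 2) ^+ a *: (Z s k ^+ a * M J).
Proof. by move=> kJ; apply: qcommX; rewrite minor_mulZ // kJ. Qed.

Lemma laplace_mulX_in (k : 'I_n) J a : k \in J ->
  N k.+1 J * Z s k ^+ a = (q ^- 2) ^+ (a + a) *: (Z s k ^+ a * N k.+1 J).
Proof.
move=> kJ; rewrite mulr_suml mulr_sumr scaler_sumr; apply: eq_bigr => j /andP[jJ kj].
have kJj : k \in J :\ j by rewrite !inE kJ -val_eqE /= ltn_eqF.
rewrite -scalerAl -mulrA minor_mulX_in // -!scalerAr mulrA row_mulX //.
by rewrite -scalerAl !scalerA !mulrA exprD; congr (_ *: _); ring.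
Qed.

(** The coefficient is a geometric sum with first term [q ^+ 2 - q ^- 2] and ratio [q ^- 4], the
    cost for a correction to pass one more factor. It is zero for [a = 0], where [a.-1] is a
    dummy. *)
Lemma minor_mulX_notin (k : 'I_n) J a : k \notin J ->
  M J * Z s k ^+ a = Z s k ^+ a * M J -
    (q ^+ 2 * (1 - (q ^- 2) ^+ (a + a))) *: (Z s k ^+ a.-1 * N k.+1 (k |: J)).
Proof.
move=> kJ; elim: a => [|a IHa].
  by rewrite !expr0 mulr1 mul1r subrr mulr0 scale0r subr0.
rewrite [in LHS]exprSr mulrA IHa mulrBl -[_ * M J * _]mulrA minor_mulZ //.
rewrite (negbTE kJ) mulrBr mulrA -exprSr -addrA -opprD; congr (_ - _).
have NZ := @laplace_mulX_in k (k |: J) 1 (setU11 _ _); rewrite expr1 in NZ.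
rewrite -scalerAr -scalerAl -[_ * N _ _ * _]mulrA NZ -scalerAr.
have -> : (q ^+ 2 * (1 - q ^- 2 ^+ (a + a))) *:
    (q ^- 2 ^+ (1 + 1) *: (Z s k ^+ a.-1 * (Z s k * N k.+1 (k |: J)))) =
  (q ^+ 2 * (1 - q ^- 2 ^+ (a + a)) * q ^- 2 ^+ (1 + 1)) *:
    (Z s k ^+ a * N k.+1 (k |: J)).
  case: a {IHa} => [|a]; first by rewrite subrr mulr0 mul0r !scale0r.
  by rewrite scalerA mulrA -exprSr.
rewrite -scalerDl /=; congr (_ *: _).
rewrite !(addSn, addnS, add0n) !exprS expr0; set e := _ ^+ (a + a); field; exact: q0.
Qed.

(** The corrections of the summands add up to a double expansion along the same row [s], which
    vanishes by [laplace2_row]. *)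
Lemma laplace_mulX_notin (k : 'I_n) J a : k \notin J ->
  N k.+1 J * Z s k ^+ a = (q ^- 2) ^+ a *: (Z s k ^+ a * N k.+1 J).
Proof.
move=> kJ; case: a => [|a]; first by rewrite !expr0 mulr1 mul1r scale1r.
set c := q ^+ 2 * (1 - (q ^- 2) ^+ (a.+1 + a.+1)) * (q ^- 2) ^+ a.
transitivity ((q ^- 2) ^+ a.+1 *: (Z s k ^+ a.+1 * N k.+1 J) - c *: (Z s k ^+ a *
    laplace q k.+1 (Z s) (laplace q k.+1 (Z s) (fun X => M (k |: X))) J)); last first.
  by rewrite laplace2_row // mulr0 scaler0 subr0.
rewrite mulr_suml !mulr_sumr !scaler_sumr -sumrB; apply: eq_bigr => j /andP[jJ kj].
have kJj : k \notin J :\ j by rewrite !inE (negbTE kJ) andbF.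
rewrite -scalerAl -mulrA minor_mulX_notin //= laplaceU // mulrBr -scalerAr !mulrA.
rewrite !row_mulX // scalerBr -!scalerAl -!scalerAr !scalerA !mulrA.
by congr (_ *: _ - _ *: _); rewrite /c; ring.
Qed.

(* The normalizations u, v of the powers make all structure constants of the
   next four identities elements of Z[q]. *)
Definition upow (k : 'I_n) a : A := q ^+ (a * a.-1) *: Z s k ^+ a.
Definition vpow (k : 'I_n) a : A := q ^+ (a * a.+1) *: Z s k ^+ a.

Lemma minor_vpow_in (k : 'I_n) J a : k \in J -> M J * vpow k a = upow k a * M J.
Proof.
move=> kJ; rewrite -scalerAr minor_mulX_in // -scalerAl scalerA; congr (_ *: _).
case: a => [|a] /=; first by rewrite !expr0 mulr1.
have -> : (a.+1 * a.+2 = a.+1 * a + a.+1 * 2)%N by lia.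
by rewrite exprD -exprVn -exprM -mulrA (mulnC 2) -exprMn divff // expr1n mulr1.
Qed.

Lemma minor_vpow_notin (k : 'I_n) J a : k \notin J ->
  M J * vpow k a = q ^+ (2 * a) *: (upow k a * M J) -
    (q ^+ (4 * a) - 1) *: (upow k a.-1 * N k.+1 (k |: J)).
Proof.
move=> kJ; rewrite -scalerAr minor_mulX_notin // scalerBr -!scalerAl !scalerA.
congr (_ *: _ - _ *: _).
  by rewrite -exprD; congr (_ ^+ _); case: a => [|a] /=; lia.
case: a => [|a] /=; first by rewrite muln0 addn0 !expr0 !subrr !mulr0 mul0r.
have -> : (a.+1 * a.+2 = 4 * a.+1 - 2 + a * a.-1)%N by case: a => [|a] /=; lia.
have -> : (4 * a.+1 - 2 = 4 * a + 2)%N by lia.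
have -> : (4 * a.+1 = 4 * a + 4)%N by lia.
have -> : (a.+1 + a.+1 = 2 * a + 2)%N by lia.
rewrite -exprVn -exprM mulnDr mulnA (_ : 2 * 2 = 4)%N // exprVn.
rewrite [_ ^+ (4 * a + 2 + _)]exprD !exprD; field; by rewrite !expf_neq0 ?q0.
Qed.

(** Taking the entry of row [s] at [k] has coefficient exactly 1, postponing it has
    [- q ^+ (2 * a + 2)]. The latter is the sum of two contributions: the correction from
    [minor_vpow_notin] and the tail of the expansion. *)
Lemma laplace_vpow_in (k : 'I_n) J a : k \in J ->
  N k J * vpow k a =
    upow k a.+1 * M (J :\ k) + (p * q ^+ (2 * a)) *: (upow k a * N k.+1 J).
Proof.
move=> kJ; rewrite /= laplace_in // mulrDl -mulrA -[in X in _ + X = _]scalerAl.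
rewrite minor_vpow_notin ?setD11 // setD1K //.
have -> : N k.+1 J * vpow k a = (q ^- 2) ^+ (a + a) *: (vpow k a * N k.+1 J).
  by rewrite -scalerAr laplace_mulX_in // -[in RHS]scalerAl !scalerA mulrC.
rewrite /upow /vpow -!scalerAl !mulrBr -!scalerAr !mulrA -[Z s k * Z s k ^+ a]exprS -addrA.
rewrite !scalerA -exprD; congr (_ *: _ + _).
  by congr (_ ^+ _); case: a => [|a] /=; lia.
case: a => [|a].
  by rewrite !muln0 !mul0n /= !expr0 subrr mul0r scale0r oppr0 add0r !mulr1 !mul1r.
rewrite [a.+1.-1]/= -[Z s k * Z s k ^+ a]exprS -scaleNr -scalerDl; congr (_ *: _).
have -> : (a.+1 * a.+2 = a * a.-1 + (4 * a + 2))%N by case: a => [|a] /=; lia.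
have -> : (a.+1 * a = a * a.-1 + 2 * a)%N by case: a => [|a] /=; lia.
have -> : (4 * a.+1 = 4 * a + 4)%N by lia.
have -> : (2 * a.+1 = 2 * a + 2)%N by lia.
have -> : (4 * a = 2 * a + 2 * a)%N by lia.
have -> : (a.+1 + a.+1 = 2 * a + 2)%N by lia.
rewrite -exprVn -exprM mulnDr mulnA (_ : 2 * 2 = 4)%N // exprVn.
have -> : (4 * a = 2 * a + 2 * a)%N by lia.
rewrite !exprD; field; by rewrite !expf_neq0 ?q0.
Qed.

Lemma laplace_vpow_notin (k : 'I_n) J a : k \notin J ->
  N k J * vpow k a = upow k a * N k.+1 J.
Proof.
move=> kJ; rewrite /= laplace_notin // -scalerAr laplace_mulX_notin // -scalerAl scalerA.
congr (_ *: _).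
case: a => [|a] /=; first by rewrite !expr0 mulr1.
have -> : (a.+1 * a.+2 = a.+1 * a + a.+1 * 2)%N by lia.
by rewrite exprD -exprVn -exprM -mulrA (mulnC 2) -exprMn divff // expr1n mulr1.
Qed.

End RowPush.

(** * Ordered monomials and their Z[q]-spans *)

Lemma q_neq0 : q != 0.
Proof. by rewrite /q tofrac_eq0 polyX_eq0. Qed.

Lemma ZqD c d : Zq c -> Zq d -> Zq (c + d).
Proof. by move=> [f ->] [g ->]; exists (f + g); rewrite rmorphD hornerD. Qed.

Lemma ZqM c d : Zq c -> Zq d -> Zq (c * d).
Proof. by move=> [f ->] [g ->]; exists (f * g); rewrite rmorphM hornerM. Qed.

Lemma ZqN c : Zq c -> Zq (- c).
Proof. by move=> [f ->]; exists (- f); rewrite rmorphN hornerN. Qed.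

Lemma Zq_int (m : int) : Zq m%:~R.
Proof. by exists m%:P; rewrite map_polyC hornerC. Qed.

Lemma Zq0 : Zq 0. Proof. exact: (Zq_int 0). Qed.
Lemma Zq1 : Zq 1. Proof. exact: (Zq_int 1). Qed.

Lemma ZqX k : Zq (q ^+ k).
Proof. by exists 'X^k; rewrite map_polyXn hornerXn. Qed.

Lemma scale_mull (A : algType Qq) (x y z : A) a c :
  x * y = q ^ c *: z -> (q ^ a *: x) * y = q ^ (a + c) *: z.
Proof. by move=> xy; rewrite -scalerAl xy scalerA expfzDr // q_neq0. Qed.

Lemma scale_mulr (A : algType Qq) (x y z : A) a c :
  x * y = q ^ c *: z -> x * (q ^ a *: y) = q ^ (a + c) *: z.
Proof. by move=> xy; rewrite -scalerAr xy scalerA expfzDr // q_neq0. Qed.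

Section OrderedProduct.
Variables (R : pzRingType) (n : nat).
Implicit Types (B : 'M[nat]_n).

Lemma big_ord_first m (s : 'I_m) (f g : 'I_m -> R) x :
    (forall i : 'I_m, (i < s)%N -> f i = 1 /\ g i = 1) ->
    (forall i : 'I_m, (s < i)%N -> f i = g i) -> f s = x * g s ->
  \prod_i f i = x * \prod_i g i.
Proof.
elim: m s f g => [|m IHm] s f g; first by case: s.
move=> f1 fg fs; rewrite !big_ord_recl.
case: (unliftP ord0 s) fs f1 fg => [s' ->|->] fs f1 fg.
  have [-> ->] := f1 ord0 isT; rewrite !mul1r.
  by apply: (IHm s') => // i; [apply: (f1 (lift ord0 i))|apply: (fg (lift ord0 i))].
by rewrite fs mulrA; congr (_ * _); apply: eq_bigr => i _; apply: fg.
Qed.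

Definition oprod (F : 'I_n -> 'I_n -> nat -> R) B : R :=
  \prod_i \prod_j F i j (B i j).

Lemma eq_oprod F G B :
  (forall i j, F i j (B i j) = G i j (B i j)) -> oprod F B = oprod G B.
Proof. by move=> FG; apply: eq_bigr => i _; apply: eq_bigr => j _; apply: FG. Qed.

(** With [k.+1] for [k], this is what [oprod_incr] needs to put a power of position [(s, k)] in
    front of an ordered product. *)
Definition supp (s k : nat) B :=
  forall i j : 'I_n, (i < s)%N || (i == s :> nat) && (j < k)%N -> B i j = 0%N.

Definition incr (s k : 'I_n) (a : nat) B : 'M[nat]_n :=
  \matrix_(i, j) (B i j + ((i == s) && (j == k)) * a)%N.

Lemma incr_row s k a B i :
  (\sum_j incr s k a B i j = \sum_j B i j + (i == s) * a)%N.
Proof.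
under eq_bigr do rewrite mxE; rewrite big_split /=; congr addn.
by rewrite (bigD1 k) //= eqxx andbT big1 ?addn0 // => j /negbTE ->; rewrite andbF.
Qed.

Lemma incr_col s k a B j :
  (\sum_i incr s k a B i j = \sum_i B i j + (j == k) * a)%N.
Proof.
under eq_bigr do rewrite mxE; rewrite big_split /=; congr addn.
by rewrite (bigD1 s) //= eqxx andTb big1 ?addn0 // => i /negbTE ->.
Qed.

Lemma supp_incr (s k : 'I_n) a B : supp s k.+1 B -> supp s k (incr s k a B).
Proof.
move=> sB i j ij; rewrite mxE sB ?add0n; last by move: ij; lia.
case: eqP => [ei|] //=; case: eqP => [ej|] //=.
by move: ij; rewrite ei ej !ltnn andbF.
Qed.

Lemma supp_decomp (s k : 'I_n) B : supp s k B ->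
  exists2 B', supp s k.+1 B' & B = incr s k (B s k) B'.
Proof.
move=> sB; exists (\matrix_(i, j) if (i == s) && (j == k) then 0%N else B i j).
  move=> i j ij; rewrite mxE; case: ifPn => // ijsk; apply: sB.
  by move: ij ijsk; rewrite -!val_eqE /=; lia.
by apply/matrixP => i j; rewrite !mxE; case: eqP => [->|]; case: eqP => [->|] //=; lia.
Qed.

Lemma oprod_incr F (s k : 'I_n) a B : (forall i j, F i j 0%N = 1) ->
  supp s k.+1 B -> oprod F (incr s k a B) = F s k a * oprod F B.
Proof.
move=> F0 sB; apply: (big_ord_first (s := s)) => [i si|i si|].
- by split; apply: big1 => j _; rewrite ?mxE -?val_eqE ?(ltn_eqF si) /= sB ?si.
- by apply: eq_bigr => j _; rewrite mxE -val_eqE /= (gtn_eqF si) addn0.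
- apply: (big_ord_first (s := k)) => [j jk|j kj|].
  + by split; rewrite ?mxE -?val_eqE /= ?(ltn_eqF jk) ?andbF sB //= eqxx; lia.
  + by rewrite mxE -!val_eqE /= (gtn_eqF kj) andbF addn0.
  + by rewrite mxE !eqxx sB /= ?F0 ?mulr1 ?mul1n // eqxx; lia.
Qed.

End OrderedProduct.

Section Lattice.
Variables (A : algType Qq) (n : nat).
Implicit Types (P : 'M[nat]_n -> Prop) (F : 'M[nat]_n -> A).

(** Built term by term for proofs by induction; [P] serves to record the row and column sums of the
    matrices that occur. *)
Inductive lattice P F : A -> Prop :=
| Lattice0 : lattice P F 0
| LatticeS c B x : Zq c -> P B -> lattice P F x -> lattice P F (c *: F B + x).

Lemma lattice_gen P F B : P B -> lattice P F (F B).
Proof.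
move=> PB; rewrite -[F B]addr0 -[F B]scale1r.
by apply: LatticeS => //; [apply: Zq1|apply: Lattice0].
Qed.

Lemma latticeD P F x y : lattice P F x -> lattice P F y -> lattice P F (x + y).
Proof.
by elim=> [|c B z cq PB _ IH] ly; rewrite ?add0r // -addrA; apply: LatticeS; auto.
Qed.

Lemma latticeZ P F c x : Zq c -> lattice P F x -> lattice P F (c *: x).
Proof.
move=> cq; elim=> [|d B z dq PB _ IH]; first by rewrite scaler0; apply: Lattice0.
by rewrite scalerDr scalerA; apply: LatticeS => //; apply: ZqM.
Qed.

Lemma lattice_mulr P F P' F' (y : A) x : lattice P F x ->
  (forall B, P B -> lattice P' F' (y * F B)) -> lattice P' F' (y * x).
Proof.
move=> lx PP'; elim: lx => [|c B z cq PB _ IH]; first by rewrite mulr0; apply: Lattice0.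
by rewrite mulrDr -scalerAr; apply: latticeD => //; apply: latticeZ; auto.
Qed.

Lemma lattice_sub P P' F x :
  (forall B, P B -> P' B) -> lattice P F x -> lattice P' F x.
Proof.
move=> PP'; elim=> [|c B z cq PB _ IH]; first exact: Lattice0.
by apply: LatticeS; auto.
Qed.

End Lattice.

(** * Integrality of the product of a minor and a monomial *)

Section MinorLattice.
Variables (A : algType Qq) (n t : nat).
Variable Z : 'I_n -> 'I_n -> A.
Hypothesis Zqm : qmatrix q Z.
Implicit Types (B : 'M[nat]_n) (J : {set 'I_n}).

Definition rows (s : nat) : seq 'I_n := pmap insub (iota s (t - s)).

Lemma rows_cons (s : 'I_n) : (s < t)%N -> rows s = s :: rows s.+1.
Proof. by move=> st; rewrite /rows -(subnSK st) /= valK. Qed.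

Lemma rows_gt (s : nat) : all (fun i : 'I_n => s < i)%N (rows s.+1).
Proof.
apply/allP => i; rewrite mem_pmap => /mapP[m]; rewrite mem_iota => mi.
by case: insubP => // j _ /= jm [->]; lia.
Qed.

(** Normalization after the minor has passed; [vfac] is the one before. They agree in the rows from
    [t] on, which the minor does not meet. *)
Definition ufac (i j : 'I_n) (a : nat) : A :=
  if (i < t)%N then upow q Z i j a else q ^+ (a * a) *: Z i j ^+ a.
Definition vfac (i j : 'I_n) (a : nat) : A :=
  if (i < t)%N then vpow q Z i j a else q ^+ (a * a) *: Z i j ^+ a.
Local Notation U := (oprod ufac).
Local Notation V := (oprod vfac).

Lemma ufac_lt (i j : 'I_n) a : (i < t)%N -> ufac i j a = upow q Z i j a.
Proof. by rewrite /ufac => ->. Qed.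

Lemma vfac_lt (i j : 'I_n) a : (i < t)%N -> vfac i j a = vpow q Z i j a.
Proof. by rewrite /vfac => ->. Qed.

Lemma ufac0 i j : ufac i j 0 = 1.
Proof. by rewrite /ufac /upow; case: ifP; rewrite scale1r. Qed.

Lemma vfac0 i j : vfac i j 0 = 1.
Proof. by rewrite /vfac /vpow; case: ifP; rewrite scale1r. Qed.

Definition margins (s k : nat) (r c : 'I_n -> nat) B : Prop :=
  [/\ supp s k B, forall i, (\sum_j B i j)%N = r i
    & forall j, (\sum_i B i j)%N = c j].

Lemma lattice_push (s k : 'I_n) (r c r' c' : 'I_n -> nat) a x : (s < t)%N ->
    (forall i, r i = (r' i + (i == s) * a)%N) ->
    (forall j, c j = (c' j + (j == k) * a)%N) ->
  lattice (margins s k.+1 r' c') U x ->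
  lattice (margins s k r c) U (upow q Z s k a * x).
Proof.
move=> st rr' cc' lx.
apply: (lattice_mulr lx) => B [sB rB cB].
rewrite -ufac_lt // -oprod_incr //; last exact: ufac0.
apply: lattice_gen; split; first exact: supp_incr.
  by move=> i; rewrite incr_row rr' rB.
by move=> j; rewrite incr_col cc' cB.
Qed.

Lemma scalerAl2 (c : Qq) (x y w : A) : c *: (x * y) * w = c *: (x * (y * w)).
Proof. by rewrite -scalerAl mulrA. Qed.

Definition minor_claim (s : nat) : Prop := forall J r c B, supp s 0 B ->
  (forall i : 'I_n, r i = (\sum_j B i j + (s <= i < t))%N) ->
  (forall j, c j = (\sum_i B i j + (j \in J))%N) ->
  lattice (margins s 0 r c) U (minor q Z (rows s) J * V B).

(* The two states in which the minor passes the columns from k on of row s: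
   "open" if the entry of row s in the Laplace expansion is still to come. *)
Definition closed_claim (s : 'I_n) (k : nat) : Prop := forall J r c B, supp s k B ->
  (forall i : 'I_n, r i = (\sum_j B i j + (s < i < t))%N) ->
  (forall j, c j = (\sum_i B i j + (j \in J))%N) ->
  lattice (margins s k r c) U (minor q Z (rows s.+1) J * V B).

Definition open_claim (s : 'I_n) (k : nat) : Prop := forall J r c B, supp s k B ->
  (forall i : 'I_n, r i = (\sum_j B i j + (s <= i < t))%N) ->
  (forall j, c j = (\sum_i B i j + (j \in J))%N) ->
  lattice (margins s k r c) U (laplace q k (Z s) (minor q Z (rows s.+1)) J * V B).

(** Descending induction on the column, for both states at once: an open state closes when it takes
    its entry in column [k], a closed one reopens with columns [k |: J] when it passes [k] outside
    [J]. After the last column an open state is zero and a closed one is the claim for the next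
    row. *)
Lemma row_claim (s : 'I_n) k : (s < t)%N -> (k <= n)%N -> minor_claim s.+1 ->
  closed_claim s k /\ open_claim s k.
Proof.
move=> st kn IHs; rewrite -(subKn kn); elim: (n - k)%N => [|d [IH0 IH1]] {k kn}.
  rewrite subn0; split=> J r c B sB rB cB; last first.
    by rewrite laplace_ge // mul0r; apply: Lattice0.
  apply: (lattice_sub (P := margins s.+1 0 r c)) => [X [sX rX cX]|].
    split=> // i j ij; apply: sX; move: ij (ltn_ord j); lia.
  apply: IHs => // i j ij; apply: sB; move: ij (ltn_ord j); lia.
(* For [n <= d] both truncated differences are 0 and the induction hypothesis is the goal. *)
case: (ltnP d n) => dn; last first.
  by move: IH0 IH1; rewrite (_ : n - d.+1 = n - d)%N //; lia.
have kn : (n - d.+1 < n)%N by lia.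
move: IH0 IH1; rewrite -(subnSK dn); set k := Ordinal kn.
rewrite -[(n - d.+1)%N]/(val k) => IH0 IH1.
have srs := rows_gt s; have q0 := q_neq0.
split=> J r c B sB rB cB.
  have [B' sB' BE] := supp_decomp sB; set a : nat := B s k in BE.
  rewrite BE oprod_incr //; last exact: vfac0.
  rewrite vfac_lt // mulrA.
  have [kJ|kJ] := boolP (k \in J).
    rewrite minor_vpow_in // -mulrA.
    apply: (lattice_push st _ _ (IH0 _ _ _ B' sB' (fun _ => erefl) (fun _ => erefl))).
      by move=> i; rewrite rB BE incr_row; lia.
    by move=> j; rewrite cB BE incr_col; lia.
  rewrite minor_vpow_notin // mulrBl !scalerAl2.
  apply: latticeD.
    apply: latticeZ; first exact: ZqX.
    apply: (lattice_push st _ _ (IH0 _ _ _ B' sB' (fun _ => erefl) (fun _ => erefl))).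
      by move=> i; rewrite rB BE incr_row; lia.
    by move=> j; rewrite cB BE incr_col; lia.
  (* For [a = 0] the exponent [a.-1] would spoil the column sums, but then the coefficient is
     zero. *)
  rewrite -scaleNr; case: (posnP a) => [->|a0].
    by rewrite expr0 subrr oppr0 scale0r; apply: Lattice0.
  apply: latticeZ; first by apply/ZqN/ZqD; [apply: ZqX|apply/ZqN/Zq1].
  apply: (lattice_push st _ _ (IH1 _ _ _ B' sB' (fun _ => erefl) (fun _ => erefl))).
    move=> i; rewrite rB BE incr_row -val_eqE /=; case: eqP => [->|] /=; lia.
  move=> j; rewrite cB BE incr_col in_setU1; case: eqP => [->|_] /=.
    by rewrite (negbTE kJ) !mul1n addn0 -addnA add1n prednK.
  by rewrite !mul0n !addn0.
have [B' sB' BE] := supp_decomp sB; set a : nat := B s k in BE.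
rewrite BE oprod_incr //; last exact: vfac0.
rewrite vfac_lt // mulrA.
have [kJ|kJ] := boolP (k \in J).
  rewrite laplace_vpow_in // mulrDl scalerAl2 -mulrA.
  apply: latticeD.
    apply: (lattice_push st _ _ (IH0 _ _ _ B' sB' (fun _ => erefl) (fun _ => erefl))).
      by move=> i; rewrite rB BE incr_row -val_eqE /=; case: eqP => [->|] /=; lia.
    move=> j; rewrite cB BE incr_col in_setD1; case: eqP => [->|_] /=.
      by rewrite kJ !mul1n addn0 -addnA addn1.
    by rewrite !mul0n !addn0.
  apply: latticeZ; first by apply/ZqM; [apply/ZqN|]; apply: ZqX.
  apply: (lattice_push st _ _ (IH1 _ _ _ B' sB' (fun _ => erefl) (fun _ => erefl))).
    by move=> i; rewrite rB BE incr_row; lia.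
  by move=> j; rewrite cB BE incr_col; lia.
rewrite laplace_vpow_notin // -mulrA.
apply: (lattice_push st _ _ (IH1 _ _ _ B' sB' (fun _ => erefl) (fun _ => erefl))).
  by move=> i; rewrite rB BE incr_row; lia.
by move=> j; rewrite cB BE incr_col; lia.
Qed.

Lemma minor_lattice s : (t <= n)%N -> (s <= t)%N -> minor_claim s.
Proof.
move=> tn st; rewrite -(subKn st); elim: (t - s)%N => [|d IHd] {s st}.
  rewrite subn0 => J r c B sB rB cB; rewrite /rows subnn /=.
  case: eqP => [J0|_]; last by rewrite mul0r; apply: Lattice0.
  rewrite mul1r.
  (* [B] has its entries in the rows from [t] on, where the two normalizations agree. *)
  have -> : V B = U B.
    apply: eq_oprod => i j; rewrite /ufac /vfac; case: ifP => // it.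
    by rewrite sB ?it // /upow /vpow.
  apply: lattice_gen; split=> // [i|j]; first by rewrite rB; lia.
  by rewrite cB J0 in_set0 addn0.
case: (ltnP d t) => dt; last first.
  by move: IHd; rewrite (_ : t - d.+1 = t - d)%N //; lia.
have sn : (t - d.+1 < n)%N by lia.
move: IHd; rewrite -(subnSK dt); set s := Ordinal sn.
rewrite -[(t - d.+1)%N]/(val s) => IHd J r c B sB rB cB.
have st : (s < t)%N by rewrite /=; lia.
by rewrite rows_cons //; apply: (row_claim st (leq0n n) IHd).2.
Qed.

End MinorLattice.

(** * The leading term for the corner minor *)

Section LeadingTerm.
Variables (A : algType Qq) (n t : nat).
Variable Z : 'I_n -> 'I_n -> A.
Hypothesis Zqm : qmatrix q Z.
Hypothesis tn : (t <= n)%N.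
Implicit Types (B : 'M[nat]_n) (J : {set 'I_n}).
Local Notation U := (oprod (ufac t Z)).
Local Notation V := (oprod (vfac t Z)).
Local Notation margins := (margins (n := n)).

(** The columns left for the rows [s, ..., t - 1] once each earlier row [i] has taken its leading
    entry, in column [n - t + i]; [Elast s] consists of the leading entries still to come. *)
Definition lastJ (s : nat) : {set 'I_n} := [set j : 'I_n | (n - t + s <= j)%N].
Definition Elast (s : nat) : 'M[nat]_n :=
  \matrix_(i, j) ([&& (s <= i)%N, (i < t)%N & j == (n - t + i)%N :> nat] : nat).

Lemma Elast_row s (i : 'I_n) : (\sum_j Elast s i j = (s <= i < t))%N.
Proof.
have [it|ti] := ltnP i t; last first.
  by rewrite andbF big1 // => j _; rewrite mxE ltnNge ti andbF.
have jn : (n - t + i < n)%N by lia.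
rewrite (bigD1 (Ordinal jn)) //= mxE it eqxx big1 ?addn0 // => j.
by rewrite mxE -val_eqE /= => /negbTE ->; rewrite !andbF.
Qed.

Lemma Elast_col s (j : 'I_n) : (\sum_i Elast s i j = (j \in lastJ s))%N.
Proof.
have [jt|tj] := ltnP j (n - t).
  rewrite inE leqNgt (leq_trans jt) ?leq_addr //= big1 // => i _.
  by rewrite mxE; case: eqP => [ji|]; rewrite ?andbF //; lia.
have ijn : (j - (n - t) < n)%N by move: (ltn_ord j); lia.
rewrite (bigD1 (Ordinal ijn)) //= mxE inE /= big1 => [|i].
  by have jn := ltn_ord j; rewrite addn0 subnKC // eqxx; congr nat_of_bool; lia.
by rewrite mxE -val_eqE /= => ij; case: eqP => [jE|]; rewrite ?andbF //; move: ij; lia.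
Qed.

Lemma supp_addE s k B : supp s k B -> (k <= n - t + s)%N -> supp s k (B + Elast s).
Proof.
move=> sB ks i j ij; rewrite !mxE natrDE [B i j]sB // add0n; move: ij; lia.
Qed.

Lemma supp_addE1 s k B : supp s k B -> supp s k (B + Elast s.+1).
Proof.
by move=> sB i j ij; rewrite !mxE natrDE [B i j]sB // add0n; move: ij; lia.
Qed.

Lemma incr_addE (s k : 'I_n) a B E : incr s k a B + E = incr s k a (B + E).
Proof. by apply/matrixP => i j; rewrite !mxE !natrDE addnAC. Qed.

Lemma incr_Elast (s j : 'I_n) a B : (s < t)%N -> (j = n - t + s :> nat)%N ->
  incr s j a B + Elast s = incr s j a.+1 (B + Elast s.+1).
Proof.
move=> st js; apply/matrixP => x y; rewrite !mxE !natrDE -!val_eqE /= js mulnS.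
case: (val x =P s) => [->|xs]; first by rewrite leqnn ltnn st /=; lia.
rewrite !andFb !mul0n !addn0; congr (_ + _)%N; congr (nat_of_bool (_ && _)).
by rewrite [RHS]ltn_neqAle eq_sym; move/eqP: xs => ->.
Qed.

(** The row and column sums of the remainder are prescribed because [lattice_rescale] will need one
    power of [q] common to all its monomials. *)
Definition leads (s k : nat) (J : {set 'I_n}) (i0 : nat) (B X : 'M[nat]_n) (x : A) :=
  exists2 y, lattice (margins s k (fun i => \sum_j B i j + (i0 <= i < t))%N
                         (fun j => \sum_i B i j + (j \in J))%N) U y
           & x = U X + q *: y.

Lemma leads_push (s k : 'I_n) J i0 J' i0' a a' B X x : (s < t)%N ->
    (forall i : 'I_n, ((i0' <= i < t) + (i == s) * a' = (i0 <= i < t) + (i == s) * a)%N) ->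
    (forall j, ((j \in J') + (j == k) * a' = (j \in J) + (j == k) * a)%N) ->
    supp s k.+1 X ->
  leads s k.+1 J' i0' B X x ->
  leads s k J i0 (incr s k a B) (incr s k a' X) (upow q Z s k a' * x).
Proof.
move=> st rr cc sX [y ly ->]; exists (upow q Z s k a' * y).
  apply: (lattice_push st _ _ ly) => i.
    by rewrite incr_row -!addnA; congr addn; rewrite rr addnC.
  by rewrite incr_col -!addnA; congr addn; rewrite cc addnC.
rewrite mulrDr scalerAr; congr (_ + _).
by rewrite oprod_incr ?ufac_lt //; apply: ufac0.
Qed.

Definition minor_lead (s : nat) : Prop := forall B, supp s 0 B ->
  leads s 0 (lastJ s) s B (B + Elast s) (minor q Z (rows n t s) (lastJ s) * V B).

(** All columns from [k] on lie in [lastJ s.+1], so only the exact identity [minor_vpow_in] occurs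
    and this row adds no error term. *)
Lemma closed_lead (s : 'I_n) k : (s < t)%N -> minor_lead s.+1 ->
  (n - t + s < k <= n)%N -> forall B, supp s k B ->
  leads s k (lastJ s.+1) s.+1 B (B + Elast s.+1)
    (minor q Z (rows n t s.+1) (lastJ s.+1) * V B).
Proof.
move=> st IHs /andP[sk kn]; have : (n - k < t - s)%N by lia.
move: (n - k)%N (subKn kn) => m <- {k sk kn}; elim: m => [|m IHm] mt B.
  rewrite subn0 => sB; have sB' : supp s.+1 0 B.
    move=> i j ij; apply: sB; move: ij (ltn_ord j); lia.
  have [y ly ->] := IHs _ sB'; exists y => //.
  apply: lattice_sub ly => X [sX rX cX]; split=> // i j ij.
  apply: sX; move: ij (ltn_ord j); lia.
have kn : (n - m.+1 < n)%N by lia.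
have {}IHm := IHm (ltnW mt).
move: IHm; rewrite -(subnSK (_ : m < n)%N); last lia.
set k := Ordinal kn; rewrite -[(n - m.+1)%N]/(val k) => IHm sB.
have [B' sB' ->] := supp_decomp sB; set a : nat := B s k.
rewrite oprod_incr //; last exact: vfac0.
have kJ : k \in lastJ s.+1 by rewrite inE /=; lia.
rewrite vfac_lt // mulrA minor_vpow_in ?q_neq0 ?rows_gt // -mulrA incr_addE.
by apply: leads_push (IHm _ sB') => //; apply: supp_addE1.
Qed.

(** Columns left of [n - t + s] lie outside [lastJ s] and are passed exactly. In column [n - t + s]
    the leading term takes its entry; the other term has a coefficient divisible by [q], so its
    integrality, from [row_claim], suffices. *)
Lemma open_lead (s : 'I_n) k : (s < t)%N -> minor_lead s.+1 ->
  (k <= n - t + s)%N -> forall B, supp s k B ->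
  leads s k (lastJ s) s B (B + Elast s)
    (laplace q k (Z s) (minor q Z (rows n t s.+1)) (lastJ s) * V B).
Proof.
move=> st IHs kn; have : (n - t + s - k <= n - t + s)%N by lia.
move: (n - t + s - k)%N (subKn kn) => m <- {k kn}; elim: m => [|m IHm] mt B.
  have jn : (n - t + s < n)%N by lia.
  rewrite subn0; set j := Ordinal jn; rewrite -[(n - t + s)%N]/(val j) => sB.
  have [B' sB' BE] := supp_decomp sB; set a : nat := B s j in BE.
  have jJ : j \in lastJ s by rewrite inE /=.
  have JE : lastJ s :\ j = lastJ s.+1.
    by apply/setP => x; rewrite !inE -val_eqE /=; lia.
  have sjn : (n - t + s < j.+1 <= n)%N by rewrite /=; lia.
  have [y ly xE] : leads s j (lastJ s) s B (B + Elast s)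
      (upow q Z s j a.+1 * (minor q Z (rows n t s.+1) (lastJ s.+1) * V B')).
    rewrite BE incr_Elast //.
    apply: leads_push (closed_lead st IHs sjn sB') => // [i|i|]; last exact: supp_addE1.
      by rewrite -val_eqE /=; lia.
    by rewrite !inE -val_eqE /=; lia.
  have nIHs := minor_lattice Zqm tn st.
  have [_ openN] := row_claim Zqm st (jn : j.+1 <= n)%N nIHs.
  have lN := openN (lastJ s) _ _ B' sB' (fun _ => erefl) (fun _ => erefl).
  (* The coefficient [- q ^+ (2 * a).+2] of [laplace_vpow_in] with one factor [q] split off. *)
  exists (y + (- q ^+ (2 * a).+1) *: (upow q Z s j a *
    (laplace q j.+1 (Z s) (minor q Z (rows n t s.+1)) (lastJ s) * V B'))).
    apply: latticeD => //; apply: latticeZ; first exact/ZqN/ZqX.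
    by apply: (lattice_push st _ _ lN) => i; rewrite BE ?incr_row ?incr_col addnAC.
  rewrite scalerDr addrA -xE {1}BE oprod_incr //; last exact: vfac0.
  rewrite vfac_lt // [LHS]mulrA laplace_vpow_in ?q_neq0 ?rows_gt // mulrDl JE -[in LHS]mulrA.
  rewrite scalerAl2 scalerA; congr (_ + _ *: _).
  by rewrite mulrN mulNr -!exprS -exprD.
have kn : (n - t + s - m.+1 < n)%N by lia.
have {}IHm := IHm (ltnW mt).
move: IHm; rewrite -(subnSK (_ : m < n - t + s)%N); last lia.
set k := Ordinal kn; rewrite -[(n - t + s - m.+1)%N]/(val k) => IHm sB.
have [B' sB' ->] := supp_decomp sB; set a : nat := B s k.
rewrite oprod_incr //; last exact: vfac0.
have kJ : k \notin lastJ s by rewrite inE /=; lia.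
rewrite vfac_lt // mulrA laplace_vpow_notin ?q_neq0 ?rows_gt // -mulrA incr_addE.
apply: leads_push (IHm _ sB') => //; apply: supp_addE => //=; lia.
Qed.

Lemma minor_leading s : (s <= t)%N -> minor_lead s.
Proof.
move=> st; rewrite -(subKn st); elim: (t - s)%N => [|d IHd] {s st}.
  rewrite subn0 => B sB; exists 0; first exact: Lattice0.
  have -> : lastJ t = set0.
    by apply/setP => j; rewrite !inE; move: (ltn_ord j); lia.
  rewrite /rows subnn /= eqxx mul1r scaler0 addr0.
  have -> : B + Elast t = B by apply/matrixP => i j; rewrite !mxE natrDE; lia.
  apply: eq_oprod => i j; rewrite /ufac /vfac; case: ifP => // it.
  by rewrite sB ?it // /upow /vpow.
case: (ltnP d t) => dt; last first.
  by move: IHd; rewrite (_ : t - d.+1 = t - d)%N //; lia.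
have sn : (t - d.+1 < n)%N by lia.
move: IHd; rewrite -(subnSK dt); set s := Ordinal sn.
rewrite -[(t - d.+1)%N]/(val s) => IHd B sB.
have st : (s < t)%N by rewrite /=; lia.
by rewrite rows_cons //; apply: open_lead.
Qed.

End LeadingTerm.

(** * Left multiplication of Z(A) by a corner minor *)

Lemma sum_sqr n (f : 'I_n -> nat) :
  ((\sum_i f i) ^ 2 = 2 * (\sum_(j < n) \sum_(k < n | k < j) f j * f k) + \sum_i f i ^ 2)%N.
Proof.
rewrite -mulnn big_distrl /=.
under eq_bigr do rewrite big_distrr /=.
pose F (j k : 'I_n) := (f j * f k)%N.
have split j : (\sum_k F j k = \sum_(k < n | k < j) F j k +
    (\sum_(k < n | j < k) F j k + f j ^ 2))%N.
  rewrite (bigID (fun k : 'I_n => k < j)%N) /=; congr addn.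
  rewrite (bigD1 j) ?ltnn //= addnC; congr addn.
  by apply: eq_bigl => k; rewrite -val_eqE /=; lia.
rewrite (eq_bigr _ (fun j _ => split j)) !big_split /= addnA mul2n -addnn.
congr (_ + _ + _)%N; rewrite (exchange_big_dep xpredT) //=.
by apply: eq_bigr => j _; apply: eq_bigr => k _; rewrite /F mulnC.
Qed.

Lemma sum_sqrD1 n (f : 'I_n -> nat) (P : pred 'I_n) :
  (\sum_i (f i + P i) ^ 2 = \sum_i f i ^ 2 + 2 * (\sum_(i | P i) f i) + \sum_i P i)%N.
Proof.
rewrite big_distrr [X in (_ + X + _)%N]big_mkcond -!big_split /=.
by apply: eq_bigr => i _; case: (P i); lia.
Qed.

Section Estimate.
Variables (A : algType Qq) (n : nat).
Variable Z : 'I_n -> 'I_n -> A.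
Hypothesis Zqm : qmatrix q Z.
Implicit Types (B : 'M[nat]_n).

Definition omon B : A := oprod (fun i j a => Z i j ^+ a) B.
Definition onorm B : A := Dfac B *: omon B.

Definition Dexp B : nat :=
  (\sum_(i < n) \sum_(j < n) \sum_(k < n | (k < j)%N) B i j * B i k +
   \sum_(i < n) \sum_(j < n) \sum_(k < n | (k < j)%N) B j i * B k i)%N.

Lemma omonE B : omon B = q ^+ Dexp B *: onorm B.
Proof. by rewrite scalerA divff ?scale1r // expf_neq0 // q_neq0. Qed.

Lemma oprod_scale (f : 'I_n -> 'I_n -> nat -> nat) (G : 'I_n -> 'I_n -> nat -> A) B :
  oprod (fun i j a => q ^+ f i j a *: G i j a) B =
    q ^+ (\sum_i \sum_j f i j (B i j))%N *: oprod G B.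
Proof.
rewrite expr_sum /oprod -scaler_prod; apply: eq_bigr => i _.
by rewrite expr_sum scaler_prod.
Qed.

(** Expand the squares of all row and column sums by [sum_sqr]. This is why [Dfac] can be replaced
    by a normalization of the single powers. *)
Lemma Dexp_sqr B :
  (2 * Dexp B + 2 * (\sum_i \sum_j B i j ^ 2) =
    \sum_i (\sum_j B i j) ^ 2 + \sum_j (\sum_i B i j) ^ 2)%N.
Proof.
rewrite (eq_bigr _ (fun i _ => sum_sqr (B i))).
rewrite [X in (_ = _ + X)%N](eq_bigr _ (fun j _ => sum_sqr (B ^~ j))).
rewrite !big_split /= [X in (_ = _ + (_ + X))%N]exchange_big /=.
rewrite [RHS]addnACA addnn -mul2n /Dexp [in LHS]mulnDr.
by rewrite !big1_eq !addn0 !mul2n -!addnn.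
Qed.

Lemma lattice_rescale (P : 'M[nat]_n -> Prop) F F' (c : Qq) (x : A) :
    (forall B, P B -> F B = c *: F' B) -> lattice P F x ->
  exists2 y, lattice (fun=> True) F' y & x = c *: y.
Proof.
move=> FF'; elim=> [|d B z dq PB _ [y ly ->]].
  by exists 0; [apply: Lattice0|rewrite scaler0].
exists (d *: F' B + y); first exact: LatticeS.
by rewrite FF' // scalerDr !scalerA mulrC.
Qed.

Lemma scaler_solve (a b : Qq) (x y : A) :
  a != 0 -> a *: x = b *: y -> x = (a^-1 * b) *: y.
Proof. by move=> a0 xy; rewrite -scalerA -xy scalerA mulVf // scale1r. Qed.

Lemma minor_mul_onorm t B : (t <= n)%N ->
  exists2 y, lattice (fun=> True) onorm y &
    minor q Z (rows n t 0) (lastJ n t 0) * onorm B =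
      q ^ ((sum_last t (co B))%:Z - (sum_first t (ro B))%:Z) *:
        (onorm (B + Elast n t 0) + q *: y).
Proof.
move=> tn.
have [y ly eVU] : leads t Z 0 0 (lastJ n t 0) 0 B (B + Elast n t 0)
    (minor q Z (rows n t 0) (lastJ n t 0) * oprod (vfac t Z) B).
  by apply: (minor_leading Zqm tn (leq0n t)) => i j; rewrite andbF.
set r := sum_first t (ro B); set c := sum_last t (co B).
pose ve (i j : 'I_n) a := (if i < t then a * a.+1 else a * a)%N.
pose ue (i j : 'I_n) a := (if i < t then a * a.-1 else a * a)%N.
pose fV (X : 'M[nat]_n) := (\sum_i \sum_j ve i j (X i j))%N.
pose fU (X : 'M[nat]_n) := (\sum_i \sum_j ue i j (X i j))%N.
have VE X : oprod (vfac t Z) X = q ^+ (fV X + Dexp X) *: onorm X.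
  rewrite exprD -scalerA -omonE /fV -(oprod_scale ve).
  by apply: eq_oprod => i j; rewrite /vfac /ve; case: ifP.
have UE X : oprod (ufac t Z) X = q ^+ (fU X + Dexp X) *: onorm X.
  rewrite exprD -scalerA -omonE /fU -(oprod_scale ue).
  by apply: eq_oprod => i j; rewrite /ufac /ue; case: ifP.
pose top (X : 'M[nat]_n) := (\sum_(i < n | i < t) \sum_j X i j)%N.
have fVE X : (fV X = \sum_i \sum_j X i j ^ 2 + top X)%N.
  rewrite /fV /top [X in (_ + X)%N]big_mkcond -big_split /=; apply: eq_bigr => i _.
  rewrite /ve /ue; case: ifP => it; last by rewrite addn0; apply: eq_bigr => j _; lia.
  by rewrite -big_split /=; apply: eq_bigr => j _; lia.
have fUE X : (fU X + top X = \sum_i \sum_j X i j ^ 2)%N.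
  rewrite /fU /top [X in (_ + X)%N]big_mkcond -big_split /=; apply: eq_bigr => i _.
  rewrite /ve /ue; case: ifP => it; last by rewrite addn0; apply: eq_bigr => j _; lia.
  by rewrite -big_split /=; apply: eq_bigr => j _; case: (X i j) => [|a] /=; lia.
have topB : top B = r by apply: eq_bigr => i _; rewrite mxE.
pose rB i := (\sum_j B i j + (0 <= i < t))%N.
pose cB j := (\sum_i B i j + (j \in lastJ n t 0))%N.
(* By [Dexp_sqr] the exponent depends on the row and column sums of [X] only, so all monomials of
   the product share it; it exceeds the exponent for [B] by [c - r]. *)
have expE (X : 'M[nat]_n) : (forall i, (\sum_j X i j)%N = rB i) ->
    (forall j, (\sum_i X i j)%N = cB j) ->
    (fU X + Dexp X + r = fV B + Dexp B + c)%N.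
  move=> Xr Xc; have eB := Dexp_sqr B; have := Dexp_sqr X.
  under [X in (_ = X + _ -> _)%N]eq_bigr do rewrite Xr.
  under [X in (_ = _ + X -> _)%N]eq_bigr do rewrite Xc.
  have topX : (top X = r + \sum_(i < n) (0 <= i < t))%N.
    rewrite -topB /top [X in (_ = _ + X)%N](bigID (fun i : 'I_n => i < t)%N) /=.
    rewrite [X in (_ = _ + (_ + X))%N]big1 ?addn0 => [|i /negbTE -> //].
    by rewrite -big_split /=; apply: eq_bigr => i _; rewrite Xr.
  have colsE : (\sum_(j < n) (j \in lastJ n t 0) = \sum_(i < n) (0 <= i < t))%N.
    under eq_bigr do rewrite -Elast_col //; under [RHS]eq_bigr do rewrite -(Elast_row tn).
    exact: exchange_big.
  rewrite !sum_sqrD1 colsE.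
  have -> : (\sum_(i < n | 0 <= i < t) \sum_j B i j = r)%N by rewrite -topB.
  have -> : (\sum_(j in lastJ n t 0) \sum_i B i j = c)%N.
    by apply: eq_big => [j|j _]; rewrite ?inE ?addn0 ?mxE.
  have := eB; have := fVE B; have := fUE X; rewrite topX topB.
  move: (\sum_i \sum_j X i j ^ 2)%N (\sum_i \sum_j B i j ^ 2)%N => SX SB.
  move: (\sum_i (\sum_j B i j) ^ 2)%N (\sum_j (\sum_i B i j) ^ 2)%N => Sr Sc.
  move: (\sum_(i < n) (0 <= i < t))%N (fU X) (fV B) (Dexp X) (Dexp B) => T u v d d'.
  by clearbody r c; clear; lia.
have BE : margins 0 0 rB cB (B + Elast n t 0).
  split=> [i j|i|j]; first by rewrite andbF.
    rewrite (eq_bigr (fun j => B i j + Elast n t 0 i j)%N) => [|j _]; last by rewrite mxE.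
    by rewrite big_split /= Elast_row.
  rewrite (eq_bigr (fun i => B i j + Elast n t 0 i j)%N) => [|i _]; last by rewrite mxE.
  by rewrite big_split /= Elast_col.
have Uq (X : 'M[nat]_n) : margins 0 0 rB cB X ->
    oprod (ufac t Z) X = q ^+ (fU (B + Elast n t 0) + Dexp (B + Elast n t 0)) *: onorm X.
  case: BE => _ BrE BcE [_ Xr Xc]; rewrite UE; congr (q ^+ _ *: _).
  by apply: (@addIn r); rewrite !expE.
have [y' ly' yE] := lattice_rescale Uq ly.
exists y' => //.
have [_ BrE BcE] := BE; have {}expE := expE _ BrE BcE.
move: eVU; rewrite VE UE yE -scalerAr [q *: _]scalerA [q * _]mulrC.
rewrite -[_ *: y']scalerA -scalerDr => eVU.
have q0 := q_neq0.
move: expE eVU; set u := (fU _ + Dexp _)%N; set v := (fV B + Dexp B)%N => expE eVU.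
have -> : q ^ (c%:Z - r%:Z) = q ^- v * q ^+ u.
  have -> : c%:Z - r%:Z = u%:Z - v%:Z by lia.
  by rewrite expfzDr // -exprnN mulrC.
by apply: scaler_solve eVU; rewrite expf_neq0.
Qed.

End Estimate.

(** * The anti-transpose *)

Section OrderedProductExchange.
Variable R : pzRingType.

Lemma prod_mul_comm m (u v : 'I_m -> R) :
    (forall j t : 'I_m, (t < j)%N -> u j * v t = v t * u j) ->
  (\prod_j u j) * (\prod_j v j) = \prod_j (u j * v j).
Proof.
elim: m u v => [|m IHm] u v uv; first by rewrite !big_ord0 mulr1.
rewrite !big_ord_recl -IHm => [|j t tj]; last exact: uv.
rewrite -!mulrA; congr (_ * _); rewrite !mulrA; congr (_ * _).
by apply/esym/commr_prod => j _; apply/esym/uv.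
Qed.

(** Passing from row order to column order interchanges only the pairs with [i < s] and [t < j]; for
    the generators these are the pairs that commute. *)
Lemma prod_exchange n m (x : 'I_n -> 'I_m -> R) :
    (forall (i s : 'I_n) (j t : 'I_m), (i < s)%N -> (t < j)%N ->
      x i j * x s t = x s t * x i j) ->
  \prod_i \prod_j x i j = \prod_j \prod_i x i j.
Proof.
elim: n x => [|n IHn] x xC.
  by rewrite big_ord0 big1 // => j _; rewrite big_ord0.
rewrite big_ord_recl IHn => [|i s j t is_ tj]; last exact: xC.
rewrite prod_mul_comm => [|j t tj]; last by apply: commr_prod => i _; apply: xC.
by apply: eq_bigr => j _; rewrite big_ord_recl.
Qed.

Lemma prod_single n (s : 'I_n) (y : 'I_n -> R) :
  \prod_i (if i == s then y i else 1) = y s.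
Proof. by rewrite -big_mkcond big_pred1_eq. Qed.

End OrderedProductExchange.

Section PermLength.

Lemma perm_len_sum t (s : 'S_t) :
  perm_len s = (\sum_(i < t) \sum_(j < t) ((i < j) && (s j < s i)))%N.
Proof.
rewrite /perm_len -sum1_card big_mkcond pair_bigA /=; apply: eq_bigr => x _.
by rewrite inE; case: ifP.
Qed.

Lemma perm_len_inv t (s : 'S_t) : perm_len s^-1 = perm_len s.
Proof.
rewrite !perm_len_sum (reindex_inj (@perm_inj _ s)) exchange_big /=.
rewrite (reindex_inj (@perm_inj _ s)) /=.
by apply: eq_bigr => i _; apply: eq_bigr => j _; rewrite !permK andbC.
Qed.

Definition rev_perm t : 'S_t := perm (@rev_ord_inj t).

Lemma rev_permE t i : rev_perm t i = rev_ord i. Proof. exact: permE. Qed.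

Lemma rev_permV t : (rev_perm t)^-1%g = rev_perm t.
Proof.
apply/eqP; rewrite eq_invg_mul; apply/eqP/permP => i.
by rewrite permM !rev_permE rev_ordK perm1.
Qed.

(** The pair [(i, j)] corresponds to [(rev_ord j, rev_ord i)], and reversing both positions and
    values preserves inversions. *)
Lemma perm_len_rev t (s : 'S_t) : perm_len (rev_perm t * s * rev_perm t)%g = perm_len s.
Proof.
rewrite !perm_len_sum (reindex_inj rev_ord_inj) exchange_big /=.
rewrite (reindex_inj rev_ord_inj) /=.
apply: eq_bigr => i _; apply: eq_bigr => j _; rewrite !permM !rev_permE !rev_ordK.
congr (nat_of_bool _); rewrite /=.
have [a b] := (ltn_ord i, ltn_ord j); have [c d] := (ltn_ord (s i), ltn_ord (s j)).
lia.
Qed.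

Lemma perm_len_lift t (x : 'I_t.+1) (s : 'S_t) :
  perm_len (lift_perm ord0 x s) = (x + perm_len s)%N.
Proof.
rewrite !perm_len_sum big_ord_recl /=; congr addn.
  rewrite big_ord_recl /= add0n lift_perm_id.
  under eq_bigr do rewrite lift_perm_lift.
  rewrite (reindex_inj (@perm_inj _ s^-1)) /=.
  under eq_bigr do rewrite permKV.
  have xt : (x <= t)%N by rewrite -ltnS.
  transitivity (\sum_(y < t | y < x) 1)%N.
    rewrite [RHS]big_mkcond; apply: eq_bigr => y _.
    by rewrite /bump; case: leqP => xy; case: ifP => //=; lia.
  by rewrite (big_ord_narrow xt) sum1_card card_ord.
apply: eq_bigr => i _; rewrite big_ord_recl /= add0n; apply: eq_bigr => j _.
rewrite !lift_perm_lift /= /bump; congr (nat_of_bool (_ && _)); lia.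
Qed.

End PermLength.

Section ConverseAlgebra.
Variables (K : fieldType) (A : algType K).

(** Left multiplication in the opposite algebra is right multiplication in [A], so [minor_mul_onorm]
    will cover both sides. *)
Definition conv_alg : Type := (A : Type)^c.
HB.instance Definition _ := GRing.NzRing.on conv_alg.

HB.instance Definition _ := GRing.Zmodule_isLmodule.Build K conv_alg
  (@scalerA K A) (@scale1r K A) (@scalerDr K A) (fun v a b => @scalerDl K A v a b).

Lemma conv_scaleAl (c : K) (x y : conv_alg) : c *: (x * y) = (c *: x) * y.
Proof. exact: (@scalerAr K A c y x). Qed.

HB.instance Definition _ := GRing.Lmodule_isLalgebra.Build K conv_alg conv_scaleAl.

Lemma conv_scaleAr (c : K) (x y : conv_alg) : c *: (x * y) = x * (c *: y).
Proof. exact: (@scalerAl K A c y x). Qed.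

HB.instance Definition _ := GRing.Lalgebra_isAlgebra.Build K conv_alg conv_scaleAr.

Lemma conv_prod n (f : 'I_n -> A) :
  \prod_(i < n) (f i : conv_alg) = \prod_(i < n) f (rev_ord i) :> A.
Proof.
elim: n f => [|n IHn] f; first by rewrite !big_ord0.
rewrite big_ord_recl big_ord_recr /=.
rewrite -[LHS]/((\prod_(i < n) (f (lift ord0 i) : conv_alg) : A) * f ord0) IHn.
congr (_ * f _); last by apply: val_inj; rewrite /= subnn.
by apply: eq_bigr => i _; congr f; apply: val_inj; rewrite /= /bump; have := ltn_ord i; lia.
Qed.

End ConverseAlgebra.

(** * Recursively defined minors as sums over permutations *)

Section MinorPermutations.
Variables (K : fieldType) (q : K) (A : algType K) (n : nat).
Variable Z : 'I_n -> 'I_n -> A.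

(** Induction along the bijection sending [(x, s)] to [lift_perm ord0 x s]. As [f] is increasing,
    [cnt] at [f x] is [x], the number of inversions gained in [perm_len_lift]. *)
Lemma minor_perm t (r f : 'I_t -> 'I_n) :
    {homo f : x y / (x < y)%N} ->
  minor q Z [seq r i | i <- enum 'I_t] [set f x | x : 'I_t] =
    \sum_(s : 'S_t) (- q ^+ 2) ^+ perm_len s *: \prod_(i < t) Z (r i) (f (s i)).
Proof.
elim: t r f => [|t IHt] r f fm.
  rewrite (_ : enum 'I_0 = [::]) /=; last by apply/size0nil; rewrite size_enum_ord.
  have -> : [set f x | x : 'I_0] == set0.
    by apply/eqP/setP => j; rewrite inE; apply/imsetP => -[[]].
  have S1 (s : 'S_0) : s = 1%g by apply/permP => -[].
  rewrite [RHS](bigD1 1%g) //= [X in _ + X]big1 => [|s]; last by rewrite (S1 s) eqxx.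
  rewrite big_ord0 addr0 perm_len_sum big_ord0 expr0 scale1r //.
have fi : injective f.
  move=> x y fxy; apply/val_inj; case: (ltngtP x y) => // /fm; rewrite fxy ltnn //.
rewrite enum_ordSl /= -map_comp /laplace.
pose g (xs : 'I_t.+1 * 'S_t) := lift_perm ord0 xs.1 xs.2.
have gi : injective g.
  move=> [x s] [y u] /permP gxy; have xy : x = y.
    by have := gxy ord0; rewrite /g /= !lift_perm_id.
  rewrite xy in gxy *; congr pair; apply/permP => i.
  by have := gxy (lift ord0 i); rewrite /g /= !lift_perm_lift => /lift_inj.
have gb : bijective g.
  by apply: inj_card_bij gi _; rewrite card_prod !card_Sn card_ord factS.
rewrite [RHS](reindex g) /=; last exact: onW_bij.
rewrite -(pair_bigA _ (fun x s => (- q ^+ 2) ^+ perm_len (lift_perm ord0 x s) *: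
   \prod_(i < t.+1) Z (r i) (f (lift_perm ord0 x s i)))) /=.
transitivity (\sum_(j in [set f x | x : 'I_t.+1])
  (- q ^+ 2) ^+ cnt 0 [set f x | x : 'I_t.+1] j *:
   (Z (r ord0) j * minor q Z [seq (r \o lift ord0) i | i <- enum 'I_t]
     ([set f x | x : 'I_t.+1] :\ j))).
  by apply: eq_bigl => j; rewrite andbT.
rewrite big_imset /=; last exact: in2W.
apply: eq_bigr => x _.
have -> : cnt 0 [set f x | x : 'I_t.+1] (f x) = x.
  rewrite /cnt big_imset /=; last exact: in2W.
  have xt : (x <= t.+1)%N := ltnW (ltn_ord x).
  transitivity (\sum_(y < t.+1 | y < x) 1)%N.
    rewrite [RHS]big_mkcond; apply: eq_bigr => y _.
    case: (ltngtP y x) => [/fm ->|/fm xy|/val_inj ->] //; last by rewrite ltnn.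
    by rewrite ltnNge ltnW.
  by rewrite (big_ord_narrow xt) sum1_card card_ord.
have -> : [set f x | x : 'I_t.+1] :\ f x = [set (f \o lift x) y | y : 'I_t].
  apply/setP => j; rewrite !inE; apply/andP/imsetP => [[jx /imsetP[y _ jE]]|[y _ ->]].
    rewrite jE in jx *; case: (unliftP x y) jx => [y' ->|->]; last by rewrite eqxx.
    by exists y'.
  by split; [rewrite (inj_eq fi) eq_sym neq_lift|apply: imset_f].
rewrite IHt => [|y z yz]; last by apply: fm; rewrite /= /bump; lia.
rewrite mulr_sumr scaler_sumr; apply: eq_bigr => s _.
rewrite -scalerAr scalerA -exprD perm_len_lift big_ord_recl lift_perm_id.
by congr (_ *: (_ * _)); apply: eq_bigr => i _; rewrite lift_perm_lift.
Qed.

End MinorPermutations.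

Lemma rows0E n t (tn : (t <= n)%N) :
  rows n t 0 = [seq widen_ord tn i | i <- enum 'I_t].
Proof.
apply: (inj_map val_inj); rewrite -map_comp (eq_map (g := val)) // val_enum_ord.
rewrite /rows subn0 (pmap_filter (insubK _)); apply/all_filterP/allP => i.
by rewrite mem_iota => it; rewrite isSome_insub; lia.
Qed.

Lemma last_ord_homo n t (tn : (t <= n)%N) : {homo last_ord tn : x y / (x < y)%N}.
Proof. by move=> x y xy; rewrite /= ltn_add2l. Qed.

Lemma lastJ0E n t (tn : (t <= n)%N) : lastJ n t 0 = [set last_ord tn x | x : 'I_t].
Proof.
apply/setP => j; rewrite inE addn0; apply/idP/imsetP => [jt|[i _ ->]]; last first.
  by rewrite /= leq_addr.
have jnt : (j - (n - t) < t)%N by have := ltn_ord j; lia.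
by exists (Ordinal jnt) => //; apply: val_inj; rewrite /= subnKC.
Qed.

Section CornerMinor.
Variables (A : algType Qq) (n t : nat).
Variable Z : 'I_n -> 'I_n -> A.

Definition corner_minor : A := minor q Z (rows n t 0) (lastJ n t 0).

Lemma corner_minorE (tn : (t <= n)%N) :
  corner_minor = \sum_(s : 'S_t) (- q ^+ 2) ^+ perm_len s *:
    \prod_(i < t) Z (widen_ord tn i) (last_ord tn (s i)).
Proof.
by rewrite /corner_minor rows0E lastJ0E minor_perm //; apply: last_ord_homo.
Qed.

End CornerMinor.

Section Converse.
Variables (A : algType Qq) (n t : nat).
Hypothesis tn : (t <= n)%N.
Variable Z : 'I_n -> 'I_n -> A.
Hypothesis Zqm : qmatrix q Z.

Definition Zconv (i j : 'I_n) : conv_alg A := Z (rev_ord j) (rev_ord i).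

Lemma qmatrix_conv : qmatrix q Zconv.
Proof.
have rv (i j : 'I_n) : (i < j)%N -> (rev_ord j < rev_ord i)%N.
  by rewrite /=; have := ltn_ord i; have := ltn_ord j; lia.
split=> [i j k jk|i j k ik|i j s u si ju|i j s u is_ ju]; rewrite /Zconv.
- exact: (qmx_col Zqm _ (rv _ _ jk)).
- exact: (qmx_row Zqm _ (rv _ _ ik)).
- exact: (esym (qmx_anti Zqm (rv _ _ ju) (rv _ _ si))).
have := qmx_diag Zqm (rv _ _ ju) (rv _ _ is_).
(* The opposite product also reverses the correction term, whose two factors commute. *)
by rewrite -(qmx_anti Zqm (rv _ _ ju) (rv _ _ is_)).
Qed.

Definition antitr (B : 'M[nat]_n) : 'M[nat]_n := \matrix_(i, j) B (rev_ord j) (rev_ord i).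

Lemma omon_tr B : omon Z B = \prod_j \prod_i Z i j ^+ B i j.
Proof.
apply: prod_exchange => i s j u is_ uj.
by apply/commrX/esym/commrX/(qmx_anti Zqm).
Qed.

Lemma omon_conv B : omon Zconv B = omon Z (antitr B) :> A.
Proof.
rewrite omon_tr /omon /oprod.
rewrite -[LHS]/(\prod_(i < n) ((\prod_(j < n) (Zconv i j ^+ B i j) : A) : conv_alg A) : A).
rewrite conv_prod; apply: eq_bigr => i _.
rewrite conv_prod; apply: eq_bigr => j _.
by rewrite mxE /Zconv !rev_ordK; apply: revrX.
Qed.

Lemma Dexp_antitr B : Dexp (antitr B) = Dexp B.
Proof.
have sq : (\sum_i \sum_j antitr B i j ^ 2 = \sum_i \sum_j B i j ^ 2)%N.
  rewrite (reindex_inj rev_ord_inj) exchange_big (reindex_inj rev_ord_inj) /=.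
  by apply: eq_bigr => i _; apply: eq_bigr => j _; rewrite mxE !rev_ordK.
have rsum : (\sum_i (\sum_j antitr B i j) ^ 2 = \sum_j (\sum_i B i j) ^ 2)%N.
  rewrite (reindex_inj rev_ord_inj); apply: eq_bigr => i _; congr (_ ^ 2)%N.
  by rewrite (reindex_inj rev_ord_inj); apply: eq_bigr => j _; rewrite mxE !rev_ordK.
have csum : (\sum_j (\sum_i antitr B i j) ^ 2 = \sum_i (\sum_j B i j) ^ 2)%N.
  rewrite (reindex_inj rev_ord_inj); apply: eq_bigr => i _; congr (_ ^ 2)%N.
  by rewrite (reindex_inj rev_ord_inj); apply: eq_bigr => j _; rewrite mxE !rev_ordK.
have := Dexp_sqr (antitr B); rewrite sq rsum csum => e1; have := Dexp_sqr B.
by rewrite [X in _ = X]addnC -e1 => /addIn /eqP; rewrite eqn_mul2l /= => /eqP.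
Qed.

Lemma onorm_conv B : onorm Zconv B = onorm Z (antitr B) :> A.
Proof. by rewrite /onorm -[Dfac (antitr B)]/(q ^- Dexp (antitr B)) Dexp_antitr -omon_conv. Qed.

Lemma antitrK : involutive antitr.
Proof. by move=> B; apply/matrixP => i j; rewrite !mxE !rev_ordK. Qed.

(** Reversing products and reflecting indices gives column-ordered products for the conjugate of [s]
    by the longest element; row order then inverts this permutation. Neither operation changes the
    length. *)
Lemma corner_minor_conv : corner_minor t Zconv = corner_minor t Z :> A.
Proof.
rewrite !(corner_minorE _ tn).
pose phi (s : 'S_t) : 'S_t := (rev_perm t * s * rev_perm t)^-1%g.
have phiK : involutive phi.
  move=> s; rewrite /phi !invMg !rev_permV invgK !mulgA.
  have rr : (rev_perm t * rev_perm t = 1)%g by rewrite -{1}rev_permV mulVg.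
  by rewrite rr mul1g -mulgA rr mulg1.
rewrite [RHS](reindex_inj (inv_inj phiK)); apply: eq_bigr => s _.
rewrite /phi perm_len_inv perm_len_rev; congr (_ *: _).
set u := (rev_perm t * s * rev_perm t)%g.
rewrite [LHS]conv_prod.
(* Filling the permutation matrix with 1 makes the product one over all positions, to which
   [prod_exchange] applies. *)
pose x (i j : 'I_t) := if i == u j then Z (widen_ord tn i) (last_ord tn j) else 1.
transitivity (\prod_j \prod_i x i j).
  apply: eq_bigr => j _; rewrite /x.
  rewrite (prod_single (u j) (fun i => Z (widen_ord tn i) (last_ord tn j))).
  rewrite /Zconv; congr (Z _ _); apply: val_inj; rewrite /= ?permM ?rev_permE /=.
    have := ltn_ord (s (rev_ord j)); lia.
  have := ltn_ord j; lia.
rewrite -prod_exchange => [|i v j w iv wj]; last first.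
  rewrite /x; case: eqP => _; case: eqP => _; rewrite ?mulr1 ?mul1r //.
  by apply/esym/(qmx_anti Zqm) => //=; rewrite ltn_add2l.
apply: eq_bigr => i _.
rewrite -(prod_single (u^-1%g i) (fun j => Z (widen_ord tn i) (last_ord tn j))).
by apply: eq_bigr => j _; rewrite /x -(canF_eq (permKV u)) eq_sym.
Qed.

Lemma antitr_addE B : antitr (B + Elast n t 0) = antitr B + Elast n t 0.
Proof.
apply/matrixP => i j; rewrite !mxE; congr (_ + _); congr nat_of_bool.
rewrite /=; have := ltn_ord i; have := ltn_ord j; lia.
Qed.

Lemma sum_first_antitr B : sum_first t (ro (antitr B)) = sum_last t (co B).
Proof.
rewrite /sum_first (reindex_inj rev_ord_inj); apply: eq_big => [i|i _].
  by rewrite /=; have := ltn_ord i; lia.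
rewrite !mxE (reindex_inj rev_ord_inj); apply: eq_bigr => j _.
by rewrite mxE !rev_ordK.
Qed.

Lemma sum_last_antitr B : sum_last t (co (antitr B)) = sum_first t (ro B).
Proof.
rewrite /sum_last (reindex_inj rev_ord_inj); apply: eq_big => [i|i _].
  by rewrite /=; have := ltn_ord i; lia.
rewrite !mxE (reindex_inj rev_ord_inj); apply: eq_bigr => j _.
by rewrite mxE !rev_ordK.
Qed.

(** [minor_mul_onorm] for [Zconv] and [antitr B]: the first row sums and the last column sums trade
    places, whence the opposite exponent. *)
Lemma mul_corner_minor B :
  exists2 y, lattice (fun=> True) (onorm Z) y &
    onorm Z B * corner_minor t Z =
      q ^ ((sum_first t (ro B))%:Z - (sum_last t (co B))%:Z) *:
        (onorm Z (B + Elast n t 0) + q *: y).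
Proof.
have [y ly yE] := minor_mul_onorm qmatrix_conv (antitr B) tn.
exists (y : A).
  elim: ly => [|c X z cq _ _ IH]; first exact: Lattice0.
  by rewrite [onorm _ X]onorm_conv; apply: LatticeS.
move: yE; rewrite -[minor _ _ _ _]/(corner_minor t Zconv) corner_minor_conv !onorm_conv.
by rewrite antitr_addE antitrK sum_first_antitr sum_last_antitr.
Qed.

End Converse.

(** * Bar invariance of quantum minors *)

Section MinorReversal.
Variables (K : fieldType) (q : K) (A : algType K) (n : nat).
Hypothesis q0 : q != 0.
Variable Z : 'I_n -> 'I_n -> A.
Hypothesis Zqm : qmatrix q Z.
Implicit Types (J : {set 'I_n}).
Local Notation p := (- q ^+ 2).

Lemma minor_rcons_swap rs (i : 'I_n) J : all (fun s : 'I_n => i < s)%N rs ->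
  minor q Z (rcons rs i) J = p ^+ size rs *: minor q Z (i :: rs) J.
Proof.
elim: rs J => [|s rs IHrs] J /=; first by rewrite scale1r.
case/andP=> is_ irs.
rewrite exprS mulrC -scalerA -laplace2_swap // /laplace scaler_sumr.
apply: eq_bigr => j _; rewrite (IHrs _ irs) -scalerAr !scalerA; congr (_ *: _).
exact: mulrC.
Qed.

Lemma minor_rev rs J : pairwise (fun i s : 'I_n => i < s)%N rs ->
  minor q Z (rev rs) J = p ^+ 'C(size rs, 2) *: minor q Z rs J.
Proof.
elim: rs J => [|i rs IHrs] J; first by rewrite scale1r.
rewrite pairwise_cons => /andP[irs prs].
rewrite rev_cons minor_rcons_swap ?all_rev // size_rev /= binS bin1 addnC exprD.
rewrite -scalerA; congr (_ *: _); rewrite /laplace scaler_sumr.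
apply: eq_bigr => j _; rewrite IHrs // -scalerAr !scalerA; congr (_ *: _).
exact: mulrC.
Qed.

Lemma minor_rcons rs (i : 'I_n) J : minor q Z (rcons rs i) J =
  \sum_(j in J) p ^+ (\sum_(l in J) (j < l))%N *: (minor q Z rs (J :\ j) * Z i j).
Proof.
elim: rs J => [|s rs IHrs] J.
  rewrite /= /laplace; apply: eq_big => [j|j]; first by rewrite andbT.
  rewrite andbT => jJ; case: eqP => [J0|_]; last by rewrite mul0r mulr0 !scaler0.
  have JE : J = [set j] by rewrite -(setD1K jJ) J0 setU0.
  by rewrite /cnt JE !big_set1 !ltnn mulr1 mul1r.
rewrite rcons_cons /= /laplace.
transitivity (\sum_(j in J) \sum_(l in J :\ j)
    p ^+ (cnt 0 J j + \sum_(m in J :\ j) (l < m))%N *: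
    (Z s j * (minor q Z rs (J :\ j :\ l) * Z i l))).
  apply: eq_big => [j|j]; rewrite andbT // => jJ.
  rewrite IHrs mulr_sumr scaler_sumr; apply: eq_bigr => l _.
  by rewrite -scalerAr scalerA -exprD.
rewrite (exchange_big_dep (mem J)) /=; last by move=> j l _; rewrite in_setD1 => /andP[].
apply: eq_bigr => l lJ; rewrite mulr_suml scaler_sumr.
apply: eq_big => [j|j]; first by rewrite !in_setD1 lJ andbT eq_sym andbC andbT.
case/andP=> jJ _; rewrite -scalerAl scalerA -exprD mulrA. congr (_ ^+ _ *: (_ * _ * _)).
  by rewrite [in RHS](big_setD1 j) //= (cntD1 _ _ lJ) addnAC.
by congr minor; apply/setP => x; rewrite !inE; case: (x =P j); case: (x =P l).
Qed.

Lemma cnt_gt_card J (j : 'I_n) : j \in J ->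
  (cnt 0 J j + \sum_(l in J) (j < l) = #|J|.-1)%N.
Proof.
move=> jJ; rewrite /cnt -big_split /= (bigD1 j) //= ltnn add0n.
rewrite (cardsD1 j) jJ -sum1_card; apply: eq_big => [i|i /andP[_]].
  by rewrite in_setD1 andbC.
by rewrite -val_eqE /=; case: ltngtP.
Qed.

(** [bar] turns the expansion along the first row into the one along the last row of [rev rs], as in
    [minor_rcons]. It inverts [p], and the columns left and right of [j] number [#|J|.-1] together,
    which is the increment of the binomial coefficient. *)
Lemma bar_minor (bar : A -> A) rs J :
    {morph bar : x y / x + y} -> (forall x y, bar (x * y) = bar y * bar x) ->
    (forall i j, bar (Z i j) = Z i j) -> bar 1 = 1 ->
    (forall k x, bar (p ^+ k *: x) = p ^- k *: bar x) ->
  p ^+ 'C(#|J|, 2) *: bar (minor q Z rs J) = minor q Z (rev rs) J.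
Proof.
move=> barD barM barZ bar1 barp.
have bar0 : bar 0 = 0 by apply: (@addrI _ (bar 0)); rewrite -barD !addr0.
have p0 : p != 0 by rewrite oppr_eq0 expf_neq0.
elim: rs J => [|i rs IHrs] J.
  rewrite /=; case: eqP => [->|_]; first by rewrite cards0 scale1r.
  by rewrite bar0 scaler0.
rewrite rev_cons minor_rcons /= /laplace (big_morph bar barD bar0) scaler_sumr.
apply: eq_big => [j|j]; rewrite andbT // => jJ.
have := cnt_gt_card jJ; rewrite (cardsD1 j J) jJ /= add0n => cE.
rewrite barp barM barZ -IHrs -scalerAl !scalerA; congr (_ *: _).
rewrite add1n binS bin1 -cE !exprD.
rewrite -!mulrA [RHS]mulrC; congr (_ * _).
by rewrite mulrCA divff ?mulr1 // expf_neq0.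
Qed.

End MinorReversal.

(** * Uniqueness of bar invariant elements *)

Lemma horner_q_inj (f g : {poly int}) :
  (map_poly intr f).[q] = (map_poly intr g).[q] -> f = g.
Proof.
have E (h : {poly int}) :
    (map_poly intr h).[q] = tofrac (map_poly intr h : {poly rat}) :> Qq.
  elim/poly_ind: h => [|h c IHh]; first by rewrite !rmorph0 horner0.
  rewrite !rmorphD !rmorphM /= !map_polyX !map_polyC hornerD hornerM hornerX hornerC.
  by rewrite IHh !rmorph_int.
move=> /eqP; rewrite !E tofrac_eq => /eqP; apply: map_inj_poly => //.
exact: intr_inj.
Qed.

(* Compare degrees: f(1/q) has no positive powers of q. *)
Lemma horner_qV_eq0 (f g : {poly int}) :
  (map_poly intr f).[q^-1] = q ^+ 2 * (map_poly intr g).[q] -> f = 0.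
Proof.
move=> fg; set m := size f.
pose R := \sum_(i < m) f`_i *: 'X^(m - i) : {poly int}.
have RE : R = 'X^(m.+2) * g.
  apply: horner_q_inj; rewrite rmorphM /= map_polyXn hornerM hornerXn.
  have -> : q ^+ m.+2 = q ^+ m * q ^+ 2 by rewrite -exprD addn2.
  rewrite -mulrA -fg (horner_coef_wide q^-1 (size_poly _ _)) mulr_sumr rmorph_sum horner_sum.
  apply: eq_bigr => i _; rewrite /= map_polyZ map_polyXn hornerZ hornerXn coef_map.
  by rewrite expfB // mulrCA exprVn.
apply/polyP => i; rewrite coef0; case: (ltnP i m) => [im|/leq_sizeP -> //].
have := congr1 (fun h : {poly int} => h`_(m - i)) RE.
rewrite coefXnM ltnS leqW ?leq_subr // coef_sum (bigD1 (Ordinal im)) //=.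
rewrite coefZ coefXn eqxx mulr1 big1 ?addr0 // => j.
rewrite -val_eqE /= coefZ coefXn => ji; case: eqP => [|_]; last by rewrite mulr0.
by have := ltn_ord j; move: ji; lia.
Qed.

Section Span.
Variables (A : algType Qq) (n : nat).
Implicit Types (F : 'M[nat]_n -> A) (s u : seq 'M[nat]_n).

(* [Zq_span] and [Zq_free] with values in an arbitrary algebra. *)
Definition Zspan F (x : A) : Prop :=
  exists (s : seq 'M[nat]_n) (c : 'M[nat]_n -> Qq),
    (forall B, Zq (c B)) /\ x = \sum_(B <- s) c B *: F B.

Definition Zfree F : Prop :=
  forall (s : seq 'M[nat]_n) (c : 'M[nat]_n -> Qq), uniq s -> (forall B, Zq (c B)) ->
    \sum_(B <- s) c B *: F B = 0 -> {in s, forall B, c B = 0}.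

(** [Zspan] allows repetitions, [Zfree] does not: multiplicities move into the coefficients, and two
    combinations can be compared over one list. *)
Lemma sum_undup s u (G : 'M[nat]_n -> A) : uniq u -> {subset s <= u} ->
  \sum_(B <- s) G B = \sum_(B <- u) (count_mem B s)%:R *: G B.
Proof.
move=> uu; elim: s => [|C s IHs] su.
  by rewrite big_nil big1 // => B _; rewrite scale0r.
rewrite big_cons IHs => [|B Bs]; last by apply: su; rewrite inE Bs orbT.
under [RHS]eq_bigr do rewrite /= natrD scalerDl.
rewrite big_split /=; congr (_ + _).
rewrite (bigD1_seq C) //=; last by apply: su; rewrite mem_head.
by rewrite eqxx scale1r big1 ?addr0 // => B BC; rewrite eq_sym (negbTE BC) scale0r.
Qed.

Lemma Zq_nat k : Zq k%:R. Proof. exact: (Zq_int k). Qed.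

Lemma Zspan_uniq F s u c : uniq u -> {subset s <= u} -> (forall B, Zq (c B)) ->
  exists2 d, (forall B, Zq (d B)) &
    \sum_(B <- s) c B *: F B = \sum_(B <- u) d B *: F B.
Proof.
move=> uu su cq; exists (fun B => (count_mem B s)%:R * c B).
  by move=> B; apply: ZqM => //; apply: Zq_nat.
by rewrite (sum_undup _ uu su); apply: eq_bigr => B _; rewrite scalerA.
Qed.

Lemma ZspanD F x y : Zspan F x -> Zspan F y -> Zspan F (x + y).
Proof.
move=> [s [c [cq ->]]] [s' [c' [cq' ->]]]; exists (undup (s ++ s')).
have uu := undup_uniq (s ++ s').
have [|d dq ->] := @Zspan_uniq F s _ c uu _ cq.
  by move=> B Bs; rewrite mem_undup mem_cat Bs.
have [|d' dq' ->] := @Zspan_uniq F s' _ c' uu _ cq'.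
  by move=> B Bs; rewrite mem_undup mem_cat Bs orbT.
exists (fun B => d B + d' B); split=> [B|]; first exact: ZqD.
by rewrite -big_split; apply: eq_bigr => B _; rewrite scalerDl.
Qed.

Lemma ZspanZ F c x : Zq c -> Zspan F x -> Zspan F (c *: x).
Proof.
move=> cq [s [d [dq ->]]]; exists s, (fun B => c * d B); split=> [B|].
  exact: ZqM.
by rewrite scaler_sumr; apply: eq_bigr => B _; rewrite scalerA.
Qed.

Lemma ZspanN F x : Zspan F x -> Zspan F (- x).
Proof. by move=> xF; rewrite -scaleN1r; apply: ZspanZ => //; apply/ZqN/Zq1. Qed.

Lemma lattice_Zspan F y : lattice (fun=> True) F y -> Zspan F y.
Proof.
elim=> [|c B x cq _ _ IH].
  by exists [::], (fun=> 0); split=> [B|]; [apply: Zq0|rewrite big_nil].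
apply: ZspanD IH; exists [:: B], (fun=> c); split=> //.
by rewrite big_seq1.
Qed.

End Span.

Section BarScalars.
Variables (A : algType Qq) (n : nat) (Z : 'I_n -> 'I_n -> A) (bar : A -> A).

Record bar_involution : Prop := BarInvolution {
  barD : {morph bar : x y / x + y};
  barM : forall x y, bar (x * y) = bar y * bar x;
  bar1 : bar 1 = 1;
  bar_inj : injective bar;
  barZ : forall i j, bar (Z i j) = Z i j;
  barq : bar q%:A = q^-1%:A }.

Hypothesis barP : bar_involution.

Lemma bar_0 : bar 0 = 0.
Proof. by apply: (@addrI _ (bar 0)); rewrite -(barD barP) !addr0. Qed.

Lemma bar_sum I (r : seq I) (G : I -> A) :
  bar (\sum_(i <- r) G i) = \sum_(i <- r) bar (G i).
Proof. exact: (big_morph bar (barD barP) bar_0). Qed.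

(** So [d] is the image of [c] under [q] to [q^-1]; as a relation it can be derived by closure
    properties from the value at [q]. *)
Definition bar_scal (c d : Qq) : Prop := forall x, bar (c *: x) = d *: bar x.

Lemma bar_scalP c d : bar c%:A = d%:A -> bar_scal c d.
Proof.
by move=> cd x; rewrite -mulr_algl (barM barP) cd mulr_algr.
Qed.

Lemma bar_scalD c d c' d' :
  bar_scal c d -> bar_scal c' d' -> bar_scal (c + c') (d + d').
Proof. by move=> cd cd' x; rewrite !scalerDl (barD barP) cd cd'. Qed.

Lemma bar_scalM c d c' d' :
  bar_scal c d -> bar_scal c' d' -> bar_scal (c * c') (d * d').
Proof. by move=> cd cd' x; rewrite -!scalerA cd cd'. Qed.

Lemma bar_scal0 : bar_scal 0 0.
Proof. by move=> x; rewrite !scale0r bar_0. Qed.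

Lemma bar_scal1 : bar_scal 1 1. Proof. by move=> x; rewrite !scale1r. Qed.

Lemma bar_scalN c d : bar_scal c d -> bar_scal (- c) (- d).
Proof.
move=> cd x; rewrite !scaleNr; apply: (@addrI _ (bar (c *: x))).
by rewrite -(barD barP) subrr cd subrr bar_0.
Qed.

Lemma bar_scal_int (m : int) : bar_scal m%:~R m%:~R.
Proof.
have bar_nat k : bar_scal k%:R k%:R.
  elim: k => [|k IHk]; first exact: bar_scal0.
  by rewrite -natr1; apply: bar_scalD => //; apply: bar_scal1.
by case: m => k; [apply: bar_nat|rewrite NegzE !rmorphN; apply/bar_scalN/bar_nat].
Qed.

Lemma bar_scalX c d k : bar_scal c d -> bar_scal (c ^+ k) (d ^+ k).
Proof.
move=> cd; elim: k => [|k IHk]; first exact: bar_scal1.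
by rewrite !exprS; apply: bar_scalM.
Qed.

Lemma bar_scalV c d : c != 0 -> bar_scal c d -> bar_scal c^-1 d^-1.
Proof.
move=> c0 cd; have d0 : d != 0.
  apply: contra_neq c0 => d0; have := cd 1; rewrite d0 scale0r -bar_0.
  by move=> /(bar_inj barP) /eqP; rewrite scaler_eq0 oner_eq0 orbF => /eqP.
move=> x; have cx : c *: (c^-1 *: x) = x by rewrite scalerA (divff c0) scale1r.
have /(scaler_solve d0) -> : d *: bar (c^-1 *: x) = 1 *: bar x.
  by rewrite -cd cx scale1r.
by rewrite mulr1.
Qed.

Lemma bar_scal_q : bar_scal q q^-1.
Proof. exact/bar_scalP/barq. Qed.

Lemma bar_scal_horner (f : {poly int}) :
  bar_scal (map_poly intr f).[q] (map_poly intr f).[q^-1].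
Proof.
elim/poly_ind: f => [|f c IHf]; first by rewrite !rmorph0 !horner0; apply: bar_scal0.
rewrite !rmorphD !rmorphM /= !map_polyX !map_polyC !hornerE.
by apply: bar_scalD (bar_scalM IHf bar_scal_q) (bar_scal_int c).
Qed.

End BarScalars.

(** * The dual canonical basis *)

Section DualCanonical.
Variables (A : algType Qq) (n : nat) (Z : 'I_n -> 'I_n -> A) (bar : A -> A).
Hypothesis Zqm : qmatrix q Z.
Hypothesis barP : bar_involution Z bar.
Variable b : 'M[nat]_n -> A.
Implicit Types (B : 'M[nat]_n).

Record dual_canonical : Prop := DualCanonical {
  dc_free : Zfree b;
  dc_span : forall x, Zspan (onorm Z) x -> Zspan b x;
  dc_bar : forall B, bar (b B) = b B;
  dc_unitri : forall B, exists (s : seq 'M[nat]_n) (h : 'M[nat]_n -> Qq),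
    {in s, forall C, [/\ qZq (h C), ro C = ro B & co C = co B]} /\
    b B = onorm Z B + \sum_(C <- s) h C *: onorm Z C }.

Hypothesis bP : dual_canonical.

Lemma dc_onorm B :
  exists2 y, lattice (fun C => ro C = ro B /\ co C = co B) (onorm Z) y &
    b B = onorm Z B + q *: y.
Proof.
have [s [h [sh ->]]] := dc_unitri bP B.
suff [y ly ->] : exists2 y,
    lattice (fun C => ro C = ro B /\ co C = co B) (onorm Z) y &
    \sum_(C <- s) h C *: onorm Z C = q *: y by exists y.
elim: s sh => [|C s IHs] sh.
  by exists 0; [apply: Lattice0|rewrite big_nil scaler0].
have [|y ly yE] := IHs; first by move=> X Xs; apply: sh; rewrite inE Xs orbT.
have [[d dq hC] rC cC] := sh C (mem_head _ _).
exists (d *: onorm Z C + y); first exact: LatticeS.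
by rewrite big_cons yE hC scalerDr [q *: (d *: _)]scalerA.
Qed.

(* Uniqueness holds since an element of q Z[q] that q -> 1/q maps to q Z[q] is 0. *)
Lemma dc_unique B x y y' : Zspan b y -> Zspan b y' ->
  x = b B + q *: y -> bar x = b B + q *: y' -> x = b B.
Proof.
move=> [s [c [cq yE]]] [s' [c' [cq' yE']]] xE xE'.
have uu := undup_uniq (s ++ s'); set u := undup _ in uu.
have [|d dq dE] := @Zspan_uniq _ _ b s _ c uu _ cq.
  by move=> C Cs; rewrite mem_undup mem_cat Cs.
have [|d' dq' dE'] := @Zspan_uniq _ _ b s' _ c' uu _ cq'.
  by move=> C Cs; rewrite mem_undup mem_cat Cs orbT.
have [f fE] := boolp.choice dq; have [g gE] := boolp.choice dq'.
pose e C := (map_poly intr (f C)).[q^-1].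
have bar_y : bar y = \sum_(C <- u) e C *: b C.
  rewrite yE dE (bar_sum barP); apply: eq_bigr => C _.
  by rewrite fE (bar_scal_horner barP) (dc_bar bP).
have q0 := q_neq0.
(* The coefficients [e C] may have negative powers of [q], while freeness is over Z[q]; the factor
   [q ^+ N] clears them all. *)
pose N := (\sum_(C <- u) size (f C))%N.
have eN C : C \in u -> Zq (q ^+ N * e C).
  move=> Cu; have le : (size (f C) <= N)%N.
    by rewrite /N (bigD1_seq C) //= leq_addr.
  rewrite /e (horner_coef_wide q^-1 (leq_trans (size_poly _ _) le)) mulr_sumr.
  elim/big_ind: _ => [|? ? ? ?|i _]; [exact: Zq0|exact: ZqD|].
  rewrite coef_map mulrCA exprVn -expfB //.
  by apply: ZqM; [apply: Zq_int|apply: ZqX].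
have rel : \sum_(C <- u) (e C - q ^+ 2 * d' C) *: b C = 0.
  have : bar x = b B + q^-1 *: bar y.
    by rewrite xE (barD barP) (dc_bar bP) (bar_scal_q barP).
  rewrite xE' => /addrI; rewrite yE' dE' bar_y => eq1.
  transitivity (\sum_(C <- u) e C *: b C - q ^+ 2 *: \sum_(C <- u) d' C *: b C).
    rewrite scaler_sumr -sumrB; apply: eq_bigr => C _.
    by rewrite scalerBl scalerA.
  have qV0 : q^-1 != 0 by rewrite invr_eq0.
  by rewrite (scaler_solve qV0 (esym eq1)) invrK -expr2 subrr.
have e0 C : C \in u -> e C = q ^+ 2 * d' C.
  move=> Cu.
  pose w C := if C \in u then q ^+ N * (e C - q ^+ 2 * d' C) else 0.
  have wq X : Zq (w X).
    rewrite /w; case: ifP => [Xu|_]; last exact: Zq0.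
    rewrite mulrBr; apply: ZqD; first exact: eN.
    by apply: ZqN; apply: ZqM; [apply: ZqX|apply: ZqM; [apply: ZqX|]].
  have w0 : \sum_(X <- u) w X *: b X = 0.
    transitivity (q ^+ N *: \sum_(X <- u) (e X - q ^+ 2 * d' X) *: b X).
      rewrite scaler_sumr big_seq [RHS]big_seq.
      by apply: eq_bigr => X Xu; rewrite /w Xu scalerA.
    by rewrite rel scaler0.
  have := dc_free bP uu wq w0 Cu; rewrite /w Cu => /eqP.
  by rewrite mulf_eq0 expf_eq0 (negbTE q0) andbF /= subr_eq0 => /eqP.
have y0 : y = 0.
  rewrite yE dE big_seq big1 // => C Cu.
  have := e0 C Cu; rewrite gE => /horner_qV_eq0 f0.
  by rewrite fE f0 rmorph0 horner0 scale0r.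
by rewrite xE y0 scaler0 addr0.
Qed.

(** Transfers a leading-term formula from [onorm B] to [b B]. All monomials of [b B] have the row
    and column sums of [B], so [f] produces the same power of [q] on each. It will serve for
    multiplication from either side. *)
Lemma dc_shift (f : A -> A) (g : 'rV[nat]_n -> 'rV[nat]_n -> int) E :
    {morph f : x y / x + y} -> (forall c x, f (c *: x) = c *: f x) ->
    (forall B, exists2 y, lattice (fun=> True) (onorm Z) y &
      f (onorm Z B) = q ^ g (ro B) (co B) *: (onorm Z (B + E) + q *: y)) ->
  forall B, exists2 y, Zspan b y &
    f (b B) = q ^ g (ro B) (co B) *: (b (B + E) + q *: y).
Proof.
move=> fD fZ fE B; have [y0 ly0 ->] := dc_onorm B.
have [y1 ly1 bE] := dc_onorm (B + E).
have [y2 ly2 fB] := fE B.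
have [y3 ly3 fy0] : exists2 y, lattice (fun=> True) (onorm Z) y &
    f y0 = q ^ g (ro B) (co B) *: y.
  elim: ly0 => [|c C x cq [rC cC] _ [y ly yE]].
    by exists 0; [apply: Lattice0|rewrite scaler0; have := fZ 0 0; rewrite !scale0r].
  have [y' ly' fC] := fE C.
  exists (c *: (onorm Z (C + E) + q *: y') + y).
    apply: latticeD => //; apply: latticeZ => //; apply: latticeD.
      exact: lattice_gen.
    by apply: latticeZ => //; rewrite -[q]expr1; apply: ZqX.
  rewrite fD fZ yE fC rC cC [RHS]scalerDr.
  congr (_ + _); rewrite /= !scalerA; congr (_ *: _); exact: mulrC.
exists (y2 + y3 - y1).
  apply: (dc_span bP); apply: ZspanD; last apply: ZspanN.
    exact/lattice_Zspan/latticeD.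
  apply: lattice_Zspan; exact: lattice_sub ly1.
rewrite bE fD [f (q *: _)]fZ fB fy0 [q *: (_ *: y3)]scalerA [q * _]mulrC.
rewrite -[_ *: y3]scalerA -scalerDr; congr (_ *: _).
by rewrite -addrA -scalerDr -[RHS]addrA -scalerDr [y1 + _]addrC subrK.
Qed.

Lemma bar_scal_qz (m : int) : bar_scal bar (q ^ m) (q ^ (- m)).
Proof.
have qk k : bar_scal bar (q ^+ k) (q ^- k).
  by rewrite -exprVn; apply/bar_scalX/(bar_scal_q barP).
case: m => k; first by rewrite -exprnN; apply: qk.
rewrite NegzE opprK -exprnN -[q ^ _]invrK; apply: (bar_scalV barP) => //.
by rewrite expf_neq0 // q_neq0.
Qed.

Variable t : nat.
Hypothesis tn : (t <= n)%N.
Local Notation det := (corner_minor t Z).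
Local Notation E := (Elast n t 0).
Local Notation expo B := ((sum_first t (ro B))%:Z - (sum_last t (co B))%:Z).

(** [bar_minor] and [minor_rev] produce the same power of [- q ^+ 2], which cancels. *)
Lemma bar_det : bar det = det.
Proof.
have q0 := q_neq0.
have p0 : - q ^+ 2 != 0 by rewrite oppr_eq0 expf_neq0.
have valrows : map val (rows n t 0) = iota 0 t.
  by rewrite (rows0E tn) -map_comp -val_enum_ord; apply: eq_map.
have sz : size (rows n t 0) = t by rewrite -(size_map val) valrows size_iota.
have cJ : #|lastJ n t 0| = t.
  rewrite (lastJ0E tn) card_imset ?card_ord // => x y /(congr1 val) /= xy.
  by apply/val_inj/(addnI xy).
have barp k x : bar ((- q ^+ 2) ^+ k *: x) = (- q ^+ 2) ^- k *: bar x.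
  have -> : (- q ^+ 2) ^- k = (- (q^-1 ^+ 2)) ^+ k.
    by rewrite -exprVn invrN exprVn.
  by apply: (bar_scalX _ (bar_scalN barP (bar_scalX _ (bar_scal_q barP)))).
have pw : pairwise (fun i j : 'I_n => i < j)%N (rows n t 0).
  have : pairwise ltn (map val (rows n t 0)).
    by rewrite valrows -sorted_pairwise ?iota_ltn_sorted //; apply: ltn_trans.
  by rewrite pairwise_map.
have rv := minor_rev q0 Zqm (lastJ n t 0) pw.
have bm := bar_minor q0 (rows n t 0) (lastJ n t 0) (barD barP) (barM barP)
  (barZ barP) (bar1 barP) barp.
rewrite sz in rv; rewrite cJ rv in bm.
have pC : (- q ^+ 2) ^+ 'C(t, 2) != 0 := expf_neq0 _ p0.
exact: scalerI pC _ _ bm.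
Qed.

Lemma dc_mul_det B :
  det * b B = q ^ (- expo B) *: b (B + E) /\ b B * det = q ^ expo B *: b (B + E).
Proof.
pose g (r c : 'rV[nat]_n) := (sum_first t r)%:Z - (sum_last t c)%:Z.
have [|c x|C|y ly lE] := @dc_shift ( *%R det) (fun r c => - g r c) E _ _ _ B.
- exact: mulrDr.
- by rewrite scalerAr.
- by rewrite opprB; apply: minor_mul_onorm.
have [x1 x2|c x|C|y' ly' rE] := @dc_shift (fun x => x * det) g E _ _ _ B.
- exact: mulrDl.
- by rewrite scalerAl.
- exact: mul_corner_minor.
have qz m : q ^ m != 0 by rewrite expfz_neq0 // q_neq0.
pose x := q ^ expo B *: (det * b B).
have xE : x = b (B + E) + q *: y.
  by rewrite /x lE scalerA -expfzDr ?q_neq0 // subrr expr0z scale1r.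
have barx : bar x = q ^ (- expo B) *: (b B * det).
  by rewrite /x bar_scal_qz (barM barP) bar_det (dc_bar bP).
have xE' : bar x = b (B + E) + q *: y'.
  by rewrite barx rE scalerA -expfzDr ?q_neq0 // addNr expr0z scale1r.
have xb := dc_unique ly ly' xE xE'.
split.
  have := scaler_solve (qz (expo B)) (_ : q ^ expo B *: (det * b B) = 1 *: b (B + E)).
  by rewrite mulr1 invr_expz; apply; rewrite scale1r -xb.
have := scaler_solve (qz (- expo B)) (_ : q ^ (- expo B) *: (b B * det) = 1 *: b (B + E)).
by rewrite mulr1 invr_expz opprK; apply; rewrite scale1r -barx xb (dc_bar bP).
Qed.

Lemma omon_trmx B : \prod_i \prod_j Z j i ^+ B i j = omon Z B^T.
Proof.
rewrite (omon_tr Zqm); apply: eq_bigr => i _; apply: eq_bigr => j _.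
by rewrite mxE.
Qed.

Lemma Dfac_trmx B : Dfac B^T = Dfac B.
Proof.
rewrite /Dfac addnC; congr (q ^- (_ + _)); apply: eq_bigr => i _;
  by apply: eq_bigr => j _; apply: eq_bigr => k _; rewrite !mxE.
Qed.

(** * Transposition and the dual canonical basis *)

Variable sigma : A -> A.

Record transposing : Prop := Transposing {
  sigmaD : {morph sigma : x y / x + y};
  sigmaM : {morph sigma : x y / x * y};
  sigma1 : sigma 1 = 1;
  sigma_scale : forall c x, sigma (c *: x) = c *: sigma x;
  sigmaZ : forall i j, sigma (Z i j) = Z j i }.

Hypothesis sigmaP : transposing.

Lemma sigma0 : sigma 0 = 0.
Proof. by have := sigma_scale sigmaP 0 0; rewrite !scale0r. Qed.

Lemma sigma_onorm B : sigma (onorm Z B) = onorm Z B^T.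
Proof.
have sigmaX x k : sigma (x ^+ k) = sigma x ^+ k.
  elim: k => [|k IHk]; first by rewrite !expr0 (sigma1 sigmaP).
  by rewrite !exprS (sigmaM sigmaP) IHk.
rewrite /onorm (sigma_scale sigmaP) Dfac_trmx -omon_trmx /omon /oprod.
rewrite (big_morph sigma (sigmaM sigmaP) (sigma1 sigmaP)).
congr (_ *: _); apply: eq_bigr => i _.
rewrite (big_morph sigma (sigmaM sigmaP) (sigma1 sigmaP)).
by apply: eq_bigr => j _; rewrite sigmaX (sigmaZ sigmaP).
Qed.

(** On monomials in the generators [sigma] and [bar] commute because they do so on each generator.
    On combinations the action of [bar] on the coefficients enters, which [bar_scal_horner] gives
    for Z[q]; hence the restriction to a lattice. *)
Lemma sigma_lattice P y : lattice P (onorm Z) y ->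
  lattice (fun=> True) (onorm Z) (sigma y) /\ bar (sigma y) = sigma (bar y).
Proof.
have bar_onorm B : bar (sigma (onorm Z B)) = sigma (bar (onorm Z B)).
  pose comm x := bar (sigma x) = sigma (bar x).
  have comm1 : comm 1 by rewrite /comm !(sigma1 sigmaP, bar1 barP).
  have commM x z : comm x -> comm z -> comm (x * z).
    by rewrite /comm => cx cz; rewrite (sigmaM sigmaP) !(barM barP) (sigmaM sigmaP) cx cz.
  have commX i j k : comm (Z i j ^+ k).
    elim: k => [|k IHk]; first by rewrite expr0.
    by rewrite exprS; apply: commM => //; rewrite /comm !(sigmaZ sigmaP, barZ barP).
  have comm_omon : comm (omon Z B).
    by apply: big_ind => // i _; apply: big_ind => // j _; apply: commX.
  have barDf : bar_scal bar (Dfac B) (q ^+ Dexp B).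
    by have := bar_scal_qz (- (Dexp B)%:Z); rewrite opprK -exprnN.
  by rewrite /onorm (sigma_scale sigmaP) !barDf comm_omon (sigma_scale sigmaP).
elim=> [|c C x [f fE] _ _ [lx ex]].
  by rewrite sigma0 (bar_0 barP) sigma0; split => //; apply: Lattice0.
rewrite (sigmaD sigmaP) (sigma_scale sigmaP) sigma_onorm !(barD barP).
rewrite (sigmaD sigmaP) ex; split.
  by apply: LatticeS => //; exists f.
congr (_ + _); rewrite fE !(bar_scal_horner barP) (sigma_scale sigmaP) -sigma_onorm.
by rewrite bar_onorm.
Qed.

Lemma sigma_dc B : sigma (b B) = b B^T.
Proof.
have [y ly bE] := dc_onorm B; have [y' ly' bE'] := dc_onorm B^T.
have [ls es] := sigma_lattice ly.
have lb : Zspan b (sigma y - y').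
  apply: (dc_span bP); apply: ZspanD; last apply: ZspanN.
    exact: lattice_Zspan.
  by apply: lattice_Zspan; apply: lattice_sub ly'.
have sE : sigma (b B) = b B^T + q *: (sigma y - y').
  rewrite bE (sigmaD sigmaP) [X in _ + X = _](sigma_scale sigmaP) sigma_onorm bE' -addrA -scalerDr.
  by rewrite [y' + _]addrC subrK.
(* Once [sigma (b B)] is known to be bar invariant, one remainder serves for both congruences. *)
apply: (dc_unique lb lb sE); rewrite -sE.
have [_ eo] := sigma_lattice (@lattice_gen _ _ (fun=> True) (onorm Z) B I).
rewrite -[in RHS](dc_bar bP B) bE (sigmaD sigmaP) [X in _ + X](sigma_scale sigmaP).
rewrite !(barD barP) eo !(bar_scal_q barP) es (sigmaD sigmaP).
by rewrite [X in _ = _ + X](sigma_scale sigmaP).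
Qed.

Lemma dc_mul_sigma_det B :
  let w := (sum_first t (co B))%:Z - (sum_last t (ro B))%:Z in
  sigma det * b B = q ^ (- w) *: b (B + E^T) /\
  b B * sigma det = q ^ w *: b (B + E^T).
Proof.
have roT : ro B^T = co B.
  by apply/rowP => i; rewrite !mxE; apply: eq_bigr => j _; rewrite mxE.
have coT : co B^T = ro B.
  by apply/rowP => i; rewrite !mxE; apply: eq_bigr => j _; rewrite mxE.
have [lE rE] := dc_mul_det B^T; rewrite roT coT in lE rE.
have bT : sigma (b (B^T + E)) = b (B + E^T).
  by rewrite sigma_dc linearD /= trmxK.
split.
  by have := congr1 sigma lE; rewrite (sigmaM sigmaP) (sigma_scale sigmaP) sigma_dc trmxK bT.
by have := congr1 sigma rE; rewrite (sigmaM sigmaP) (sigma_scale sigmaP) sigma_dc trmxK bT.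
Qed.

End DualCanonical.

(** * Specialization to [Oq q n] *)

Lemma Oq_qmatrix n : qmatrix q (@Zgen Qq q n).
Proof.
split; [exact: Zgen_row|exact: Zgen_col|exact: Zgen_anti|exact: Zgen_diag].
Qed.

Lemma Emx_Elast n t : Emx n t = Elast n t 0.
Proof. by apply/matrixP => i j; rewrite !mxE. Qed.

(** Here and in the next two lemmas the sides are convertible and differ only in the path by which
    the algebra structure is inferred; they connect the abstract results with the definitions on
    [Oq q n]. *)
Lemma Oq_sumE n (I : finType) (f : I -> Oq q n) :
  \sum_i f i = \sum_i (f i : (Oq q n : algType Qq)).
Proof. by []. Qed.
Lemma Oq_prodE n t (f : 'I_t -> Oq q n) :
  \prod_(i < t) f i = \prod_(i < t) (f i : (Oq q n : algType Qq)).
Proof. exact (erefl (\prod_(i < t) (f i : (Oq q n : algType Qq)))). Qed.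
Lemma Oq_scaleE n (c : Qq) (x : Oq q n) : c *: x = c *: (x : (Oq q n : algType Qq)).
Proof. exact (erefl (c *: (x : (Oq q n : algType Qq)))). Qed.
(* [x * y = c *: z] in the scalar multiplication of the algebra structure of
   [Oq q n] and in the one found directly on [Oq q n]. *)
Lemma Oq_mul_scale n (c : Qq) (x y z : (Oq q n : algType Qq)) :
  x * y = c *: z -> (x : Oq q n) * (y : Oq q n) = c *: (z : Oq q n).
Proof. by move=> xy; exact (etrans xy (esym (Oq_scaleE _ _))). Qed.

Lemma qZB_mull n (b : 'M[nat]_n -> Oq q n) a c (x y : (Oq q n : algType Qq)) C :
  x * y = q ^ c *: (b C : (Oq q n : algType Qq)) ->
  qZB b ((q ^ a *: (x : Oq q n)) * (y : Oq q n)).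
Proof.
move=> xy; exists (a + c), C.
have e := congr1 (fun v : Oq q n => v * (y : Oq q n)) (Oq_scaleE (q ^ a) x).
exact (etrans e (Oq_mul_scale (scale_mull a xy))).
Qed.

Lemma qZB_mulr n (b : 'M[nat]_n -> Oq q n) a c (x y : (Oq q n : algType Qq)) C :
  x * y = q ^ c *: (b C : (Oq q n : algType Qq)) ->
  qZB b ((x : Oq q n) * (q ^ a *: (y : Oq q n))).
Proof.
move=> xy; exists (a + c), C.
have e := congr1 (fun v : Oq q n => (x : Oq q n) * v) (Oq_scaleE (q ^ a) y).
exact (etrans e (Oq_mul_scale (scale_mulr a xy))).
Qed.

Lemma detq_corner_minor n t (tn : (t <= n)%N) :
  detq tn = corner_minor t (@Zgen Qq q n).
Proof.
rewrite (corner_minorE (@Zgen Qq q n) tn) /detq.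
apply: (etrans (Oq_sumE _)).
apply: eq_bigr => s _.
exact (etrans (Oq_scaleE _ _) (congr1 (fun x : (Oq q n : algType Qq) => _ *: x) (Oq_prodE _))).
Qed.
Lemma Oq_bar n (bar : Oq q n -> Oq q n) :
  is_bar bar -> bar_involution (@Zgen Qq q n) bar.
Proof.
case=> barB bar_D _ bar_1 bar_M bar_Z bar_q; split.
- exact: bar_D.
- exact: bar_M.
- exact: bar_1.
- exact: bij_inj barB.
- exact: bar_Z.
- exact: bar_q.
Qed.
Lemma Oq_dual_canonical n (bar : Oq q n -> Oq q n) b :
  is_dual_canonical_basis bar b -> dual_canonical (@Zgen Qq q n) bar b.
Proof.
move=> bP; split.
- exact: dcb_free bP.
- by move=> x; apply: (dcb_span bP x).1.
- exact: dcb_bar bP.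
move=> B; have [s [h [_ sh bE]]] := dcb_unitri bP B.
exists s, h; split; first by move=> C /sh[].
exact: bE.
Qed.

Lemma Oq_sigma n (sigma : {lrmorphism Oq q n -> Oq q n}) :
  is_sigma sigma -> transposing (@Zgen Qq q n) sigma.
Proof.
have sD : {morph sigma : x y / x + y} by exact: rmorphD.
have sM : {morph sigma : x y / x * y} by exact: rmorphM.
have s1 : sigma 1 = 1 by exact: rmorph1.
have sZ c x : sigma (c *: x) = c *: sigma x by exact: linearZ.
case=> _ sZgen; split; [exact sD|exact sM|exact s1|exact sZ|exact sZgen].
Qed.

Theorem theorem5p2 (n : nat) (bar : Oq q n -> Oq q n)
    (sigma : {lrmorphism Oq q n -> Oq q n}) (b : 'M[nat]_n -> Oq q n)
    (t : nat) (tn : (t <= n)%N) :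
  is_bar bar -> is_sigma sigma -> is_dual_canonical_basis bar b -> (0 < t)%N ->
  (forall x, qZB b x ->
     [/\ qZB b (x * detq tn), qZB b (detq tn * x),
         qZB b (x * sigma (detq tn)) & qZB b (sigma (detq tn) * x)]) /\
  (forall A : 'M[nat]_n,
     b A * detq tn =
       q ^ ((sum_first t (ro A))%:Z - (sum_last t (co A))%:Z) *:
         b (A + Emx n t) /\
     b A * sigma (detq tn) =
       q ^ ((sum_first t (co A))%:Z - (sum_last t (ro A))%:Z) *:
         b (A + (Emx n t)^T)).
Proof.
move=> /Oq_bar barP /Oq_sigma sigmaP /Oq_dual_canonical bP _.
have mul_det := @dc_mul_det _ _ _ _ (Oq_qmatrix n) barP _ bP t tn.
have mul_sigma := @dc_mul_sigma_det _ _ _ _ (Oq_qmatrix n) barP _ bP t tn sigma sigmaP.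
rewrite detq_corner_minor Emx_Elast; split=> [x [a [B ->]]|B]; last first.
  split; [exact (Oq_mul_scale (mul_det B).2)|exact (Oq_mul_scale (mul_sigma B).2)].
have [lE rE] := mul_det B; have [slE srE] := mul_sigma B.
split.
- exact (qZB_mull a rE).
- exact (qZB_mulr a lE).
- exact (qZB_mull a srE).
- exact (qZB_mulr a slE).
Qed.
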